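(* For $v\in\mathbb N^n$, $$\sum_{u\in\mathbb N^n}a^{|u|}\frac{(b)_u}{(ct^{n-1})_u}\begin{bmatrix}u\\ v\end{bmatrix}\mathsf M_u(x)=\left(\frac ac\right)^{|v|}\frac{(b)_v}{(ab/c)_v}\left(\prod_{i=1}^n\frac{(at^{n-i})_\infty\,(cx_i)_\infty}{(ct^{n-i})_\infty\,(ax_i)_\infty}\right)\sum_{u\in\mathbb N^n}c^{|u|}\frac{(ab/c)_u}{(at^{n-1})_u}\begin{bmatrix}u\\ v\end{bmatrix}\mathsf M_u(x).$$
   Context: Notation. Fix $n\ge 1$, a complex $q$ with $|q|<1$, and $t$, with $q,t$ generic (the coefficients of all polynomials below are rational functions of $q,t$). $\mathbb N=\{0,1,2,\dots\}$, $x=(x_1,\dots,x_n)$. A composition is $u=(u_1,\dots,u_n)\in\mathbb N^n$; $|u|=u_1+\cdots+u_n$; $u^+$ is the weakly decreasing rearrangement of $u$. $(b)_\infty=\prod_{i\ge0}(1-bq^i)$, $(b)_k=\prod_{i=0}^{k-1}(1-bq^i)$ for $k\in\mathbb N$, and for a composition $u$, $(b)_u=\prod_{i=1}^n(bt^{1-i})_{u^+_i}$. The spectral vector $\langle u\rangle\in\mathbb C^n$ has entries $\langle u\rangle_i=q^{u_i}t^{k_i}$, where $k_i=\#\{j:u_j<u_i\}+\#\{j>i:u_j=u_i\}$. The diagram of $u$ is the set of $s=(i,j)$ with $1\le i\le n$, $1\le j\le u_i$; for such $s$, $a(s)=u_i-j$ and $l(s)=\#\{k>i: j\le u_k\le u_i\}+\#\{k<i: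 j\le u_k+1\le u_i\}$. Put $n(u)=\sum_{s\in u}l(s)$, $n'(u)=\sum_i\binom{u_i}{2}$, $c'_u=\prod_{s\in u}(1-q^{a(s)+1}t^{l(s)})$. The interpolation Macdonald polynomial $M_u(x)$ is the unique polynomial of degree $|u|$ in $x_1,\dots,x_n$ such that $M_u(\langle v\rangle)=0$ for all $v\in\mathbb N^n$ with $|v|\le|u|$, $v\ne u$, and such that the coefficient of $x^u=x_1^{u_1}\cdots x_n^{u_n}$ is $q^{-n'(u)}$. Its normalised version is $\mathsf M_u(x)=q^{n'(u)}t^{n(u)}M_u(x)/c'_u$. The generalised $q$-binomial coefficient is $\begin{bmatrix}u\\ v\end{bmatrix}=\mathsf M_v(\langle u\rangle)/\mathsf M_v(\langle v\rangle)$; it vanishes if $|u|\le|v|$ and $u\neq v$. Parameters $a,b,c$ are generic. The identity is understood as one of formal power series: replacing $(a,c)$ by $(za,zc)$ with $b,x$ fixed, both sides are expanded as formal power series in $z$. *)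

(* Defs.v *)
From HB Require Import structures.
From mathcomp Require Import all_boot all_order all_algebra complex.
From mathcomp Require Import mathcomp_extra boolp classical_sets fsbigop reals.
From mathcomp Require Import topology normedtype sequences.
(* The notations of multinomials clash with those of MathComp-Analysis:
   {mpoly K[n]} is written mpoly n K, 'X_{1..n} is multinom n, p.@[x] is
   meval x p, and p@_u is mcoeff u p. *)
From mathcomp Require Import -(notations) mpoly.

Set Implicit Arguments.
Unset Strict Implicit.
Unset Printing Implicit Defensive.

Import Order.TTheory GRing.Theory Num.Theory numFieldNormedType.Exports.
Local Open Scope ring_scope.

(** * Formal power series in one variable z *)

Record fps (K : fieldType) := Fps { coefps : nat -> K }.

Section FpsRing.
Variable K : fieldType.
Implicit Types f g h : fps K.

Lemma fpsP f g : (forall k, coefps f k = coefps g k) -> f = g.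
Proof. by case: f g => [f] [g] /= /funext ->. Qed.

HB.instance Definition _ := gen_eqMixin (fps K).
HB.instance Definition _ := gen_choiceMixin (fps K).

Definition fpsC (c : K) : fps K := Fps (fun k => c *+ (k == 0%N)).
Definition fpsX : fps K := Fps (fun k => (k == 1%N)%:R).

Definition fps_opp f := Fps (fun k => - coefps f k).
Definition fps_add f g := Fps (fun k => coefps f k + coefps g k).
Definition fps_mul f g :=
  Fps (fun k => \sum_(i < k.+1) coefps f i * coefps g (k - i)).

Lemma fps_addA : associative fps_add.
Proof. by move=> f g h; apply: fpsP => k /=; rewrite addrA. Qed.
Lemma fps_addC : commutative fps_add.
Proof. by move=> f g; apply: fpsP => k /=; rewrite addrC. Qed.
Lemma fps_add0 : left_id (fpsC 0) fps_add.
Proof. by move=> f; apply: fpsP => k /=; rewrite mul0rn add0r. Qed.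
Lemma fps_addN : left_inverse (fpsC 0) fps_opp fps_add.
Proof. by move=> f; apply: fpsP => k /=; rewrite mul0rn addNr. Qed.

HB.instance Definition _ :=
  GRing.isZmodule.Build (fps K) fps_addA fps_addC fps_add0 fps_addN.

Definition fps_trunc m f : {poly K} := \poly_(i < m) coefps f i.

Lemma coef_fps_trunc_mul m f g k : (k < m)%N ->
  (fps_trunc m f * fps_trunc m g)`_k = coefps (fps_mul f g) k.
Proof.
move=> km; rewrite coefM /=; apply: eq_bigr => i _.
rewrite !coef_poly (leq_ltn_trans (leq_subr _ _) km).
by rewrite (leq_ltn_trans _ km) // -ltnS.
Qed.

Lemma fps_mulA : associative fps_mul.
Proof.
move=> f g h; apply: fpsP => k.
pose T := fps_trunc k.+1.
have tr (p : {poly K}) f' : (forall i, (i <= k)%N -> p`_i = coefps f' i) ->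
    forall i, (i <= k)%N -> p`_i = (T f')`_i.
  by move=> pf i ik; rewrite pf // coef_poly ltnS ik.
have eL : (T f * (T g * T h))`_k = coefps (fps_mul f (fps_mul g h)) k.
  rewrite -(@coef_fps_trunc_mul k.+1) // !coefM; apply: eq_bigr => i _.
  by congr (_ * _); apply: tr (leq_subr _ _) => j jk;
    rewrite coef_fps_trunc_mul.
have eR : (T f * T g * T h)`_k = coefps (fps_mul (fps_mul f g) h) k.
  rewrite -(@coef_fps_trunc_mul k.+1) // !coefM; apply: eq_bigr => i _.
  by congr (_ * _); apply: tr => [j jk|];
    rewrite ?coef_fps_trunc_mul // -ltnS.
by rewrite -eL -eR mulrA.
Qed.

Lemma fps_mulC : commutative fps_mul.
Proof.
move=> f g; apply: fpsP => k.
by rewrite -!(@coef_fps_trunc_mul k.+1) // mulrC.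
Qed.

Lemma fps_mul1 : left_id (fpsC 1) fps_mul.
Proof.
move=> f; apply: fpsP => k /=.
by rewrite big_ord_recl /= subn0 mul1r big1 ?addr0 // => i _; rewrite mul0r.
Qed.

Lemma fps_mulDl : left_distributive fps_mul fps_add.
Proof.
move=> f g h; apply: fpsP => k /=; rewrite -big_split /=.
by apply: eq_bigr => i _; rewrite mulrDl.
Qed.

Lemma fps_oner_neq0 : fpsC 1 != 0.
Proof.
apply/eqP => /(congr1 (fun f => coefps f 0)) /= /eqP.
by rewrite mul0rn mulr1n oner_eq0.
Qed.

HB.instance Definition _ := GRing.Zmodule_isComNzRing.Build (fps K)
  fps_mulA fps_mulC fps_mul1 fps_mulDl fps_oner_neq0.

(* The first m coefficients of 1 / f, by the recursion expressing that
   (1 / f) * f has coefficients 1, 0, 0, ... *)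
Fixpoint fps_inv_seq f m : seq K :=
  if m is k.+1 then
    let s := fps_inv_seq f k in
    rcons s
      (((k == 0%N)%:R - \sum_(i < k) s`_i * coefps f (k - i)) / coefps f 0)
  else [::].

Definition fps_unit : pred (fps K) := fun f => coefps f 0 != 0.
Definition fps_inv f : fps K :=
  if fps_unit f then Fps (fun k => (fps_inv_seq f k.+1)`_k) else f.

Lemma size_fps_inv_seq f m : size (fps_inv_seq f m) = m.
Proof. by elim: m => //= m IHm; rewrite size_rcons IHm. Qed.

Lemma nth_fps_inv_seq f m k : (k < m)%N ->
  (fps_inv_seq f m)`_k = (fps_inv_seq f k.+1)`_k.
Proof.
elim: m => // m IHm; rewrite ltnS leq_eqVlt => /predU1P[-> //|km].
by rewrite [LHS]/= nth_rcons size_fps_inv_seq km IHm.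
Qed.

Lemma coef_fps_inv f k : fps_unit f ->
  coefps (fps_inv f) k =
  ((k == 0%N)%:R - \sum_(i < k) coefps (fps_inv f) i * coefps f (k - i))
    / coefps f 0.
Proof.
rewrite /fps_inv => ->; rewrite [LHS]/= nth_rcons size_fps_inv_seq ltnn eqxx.
congr ((_ - _) / _); apply: eq_bigr => i _; congr (_ * _).
exact: nth_fps_inv_seq.
Qed.

Lemma fps_mulV : {in fps_unit, left_inverse 1 fps_inv *%R}.
Proof.
move=> f fU; apply: fpsP => k; rewrite [LHS]/= big_ord_recr /= subnn.
by rewrite (coef_fps_inv k fU) divfK // addrC subrK.
Qed.

Lemma fps_unitP f g : g * f = 1 -> fps_unit f.
Proof.
move=> /(congr1 (fun h => coefps h 0)) /=.
rewrite big_ord1 /= => gf; apply/eqP => f0; move: gf.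
by rewrite f0 mulr0 => /esym/eqP; rewrite mulr1n oner_eq0.
Qed.

Lemma fps_inv_out : {in [predC fps_unit], fps_inv =1 id}.
Proof. by move=> f /negbTE fU; rewrite /fps_inv [fps_unit f]fU. Qed.

HB.instance Definition _ := GRing.ComNzRing_hasMulInverse.Build (fps K)
  fps_mulV fps_unitP fps_inv_out.

End FpsRing.

Arguments fpsX {K}.
Notation "c %:S" := (fpsC c) (at level 1, left associativity, format "c %:S").

(* Sum of a family in which every power of z occurs in only finitely many
   members. *)
Definition fps_sum (K : fieldType) (I : choiceType) (F : I -> fps K) : fps K :=
  Fps (fun k => \sum_(i \in [set: I]%classic) coefps (F i) k).

(* Coefficientwise limit. *)
Definition fps_lim (K : numFieldType) (f : nat -> fps K) : fps K :=
  Fps (fun k => limn (fun N => coefps (f N) k)).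

(** * q-shifted factorials *)

Definition qpoch (A : comUnitRingType) (q b : A) (k : nat) : A :=
  \prod_(i < k) (1 - b * q ^+ i).

Definition dominant n (u : multinom n) : seq nat := sort geq (codom u).

(* Indices start at 0, so that t ^ (1 - i) becomes t ^ (- i). *)
Definition qpoch_comp (A : comUnitRingType) n (q t b : A) (u : multinom n) : A :=
  \prod_(i < n) qpoch q (b * t ^- i) (nth 0%N (dominant u) i).

Definition qpoch_infty (K : numFieldType) (q : K) (b : fps K) : fps K :=
  fps_lim (qpoch q%:S b).

(** * Interpolation Macdonald polynomials *)

Section Interpolation.
Variables (K : fieldType) (n : nat).
Implicit Types (q t : K) (u v : multinom n).

Definition spectral_exp u (i : 'I_n) : nat :=
  #|[pred j : 'I_n | (u j < u i)%N]|
  + #|[pred j : 'I_n | (i < j)%N && (u j == u i)]|.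

Definition spectral q t u : 'I_n -> K :=
  fun i => q ^+ u i * t ^+ spectral_exp u i.

(* Leg length of the square in row i and column j, with 1 <= j <= u i. *)
Definition leg u (i : 'I_n) (j : nat) : nat :=
  #|[pred k : 'I_n | (i < k)%N && (j <= u k <= u i)%N]|
  + #|[pred k : 'I_n | (k < i)%N && (j <= (u k).+1 <= u i)%N]|.

Definition nstat u : nat :=
  (\sum_(i < n) \sum_(1 <= j < (u i).+1) leg u i j)%N.

Definition nstat' u : nat := (\sum_(i < n) 'C(u i, 2))%N.

Definition cprime q t u : K :=
  \prod_(i < n) \prod_(1 <= j < (u i).+1)
    (1 - q ^+ (u i - j).+1 * t ^+ leg u i j).

(* msize p is the total degree of p plus one. *)
Definition interp_spec q t u (p : mpoly n K) : Prop :=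
  [/\ msize p = (mdeg u).+1,
      forall v, (mdeg v <= mdeg u)%N -> v != u -> meval (spectral q t v) p = 0
    & mcoeff u p = q ^- nstat' u].

Definition interpM q t u : mpoly n K := xget 0 [set p | interp_spec q t u p]%classic.

Definition interpMnorm q t u : mpoly n K :=
  (q ^+ nstat' u * t ^+ nstat u / cprime q t u) *: interpM q t u.

Definition gbinom q t u v : K :=
  meval (spectral q t u) (interpMnorm q t v)
  / meval (spectral q t v) (interpMnorm q t v).

End Interpolation.

(* Every denominator in q and t above is, up to powers of q and t, a product of
   factors 1 - q^i t^j with (i, j) != (0, 0). *)
Definition generic (K : fieldType) (q t : K) : Prop :=
  [/\ q != 0, t != 0 & forall i j : int, q ^ i * t ^ j = 1 -> i = 0 /\ j = 0].

(* Main.v *)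
Require Import Defs.
From HB Require Import structures.
From mathcomp Require Import all_boot all_order all_algebra complex all_fingroup.
From mathcomp Require Import mathcomp_extra boolp classical_sets fsbigop reals.
From mathcomp Require Import topology normedtype sequences.
From mathcomp Require Import -(notations) mpoly.
From mathcomp Require Import zify ring.

Set Implicit Arguments.
Unset Strict Implicit.
Unset Printing Implicit Defensive.

Import Order.TTheory GRing.Theory Num.Theory numFieldNormedType.Exports.
Local Open Scope ring_scope.

(* Write [u v] for the binomial coefficient, S_u(z) = (z t^(n-1))_u and
   P(z; x) = \prod_i (z t^(n-i))_oo / (z x_i)_oo, so that P(z; <w>) = S_w(z).

   The polynomials M_u are built by the Knop-Sahi recursion, from the affine
   rotation u |-> (u_2, ..., u_n, u_1 + 1) and from Demazure-Lusztig operators;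
   the recursion also gives M_u(<u>), which after normalisation is the leading
   coefficient of S_u.  As eigenfunctions of the Cherednik operators they satisfy
   the extra vanishing M_v(<w>) = 0 unless v^+ is contained in w^+, and in the
   latter case S_v divides S_w.  Hence the coefficient of z^k in
   M_v(x) P(z; x) / S_v(z), which has degree at most |v| + k in x, vanishes at
   <w> for |w| < |v| + k, and evaluating it at |w| = |v| + k gives
     z^|v| M_v(x) P(z; x) / S_v(z) = \sum_u z^|u| [u v] M_u(x).          (1)
   At x = <w> this expands [w v] S_w(z) / S_v(z) in powers of z.  Its top degree
   part says that the matrices (s^(|u|-|v|) [u v])_(u, v) represent the
   multiplication by \prod_i 1 / (s x_i)_oo, so they commute for varying s:
     \sum_u A^|u| [w u][u y] = A^(|w|+|y|) \sum_u A^(-|u|) [w u][u y].   (2)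
   After multiplication by P(zc; x), (1) turns the left-hand side of the theorem
   into a combination of the M_w(x) whose coefficients are compared with those of
   the right-hand side by expanding (b)_u with (1) and applying (2). *)

(** * Ranks, arms and legs of compositions *)

Section Rank.
Variable n : nat.
Implicit Types (u v w : multinom n) (i j k : 'I_n).

(** The strict total order on indices whose ranks are the exponents of t in <u>; among equal parts
    the rightmost is lowest. *)
Definition below u j i := (u j < u i)%N || ((u j == u i) && (i < j)%N).

Lemma spectral_expE u i : spectral_exp u i = #|[pred j | below u j i]|.
Proof.
rewrite /spectral_exp -cardUI [X in (_ + X)%N]eq_card0 ?addn0; last first.
  by move=> j; rewrite !inE; apply/negbTE/negP => /andP[] /=; lia.
by apply: eq_card => j; rewrite !inE /below andbC.
Qed.

Lemma below_trans u i j k : below u i j -> below u j k -> below u i k.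
Proof. by rewrite /below; lia. Qed.

Lemma below_irr u i : below u i i = false.
Proof. by rewrite /below ltnn eqxx ltnn. Qed.

Lemma below_total u i j : i != j -> below u i j || below u j i.
Proof. by rewrite -val_eqE /below /=; lia. Qed.

Lemma rank_mono u i j : below u i j -> (spectral_exp u i < spectral_exp u j)%N.
Proof.
move=> ij; rewrite !spectral_expE; apply: proper_card; apply/properP; split.
  by apply/fintype.subsetP => k; rewrite !inE => ki; exact: below_trans ij.
by exists i; rewrite !inE // below_irr.
Qed.

Lemma rank_below u i j : (spectral_exp u i < spectral_exp u j)%N = below u i j.
Proof.
apply/idP/idP => [lt_ij|]; last exact: rank_mono.
have [/eqP eq_ij|/(below_total u)/orP[//|/rank_mono]] := eqVneq i j.
  by rewrite (eqP eq_ij) ltnn in lt_ij.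
by move/(ltn_trans lt_ij); rewrite ltnn.
Qed.

Lemma rank_inj u : injective (spectral_exp u).
Proof.
move=> i j eq_ij; apply/eqP; apply: contraT => /(below_total u).
by rewrite -!rank_below eq_ij ltnn.
Qed.

Lemma rank_lt u i : (spectral_exp u i < n)%N.
Proof.
rewrite spectral_expE -[X in (_ < X)%N]card_ord; apply: proper_card.
by apply/properP; split; [apply/fintype.subsetP|exists i; rewrite // !inE below_irr].
Qed.

Definition rank_ord u i := Ordinal (rank_lt u i).

Lemma rank_ord_inj u : injective (rank_ord u).
Proof. by move=> i j [] /rank_inj. Qed.

Lemma rank_le_parts u i j :
  (spectral_exp u i <= spectral_exp u j)%N -> (u i <= u j)%N.
Proof.
apply: contraTT; rewrite -!ltnNge => lt_ji.
by apply: rank_mono; rewrite /below lt_ji.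
Qed.

Lemma nth_dominant u i :
  nth 0%N (dominant u) (rev_ord (rank_ord u i)) = u i.
Proof.
(* [h] lists the indices by decreasing rank, so the list of the [u (h p)] is sorted. *)
pose h p := invF (@rank_ord_inj u) (rev_ord p).
have h_inj : injective h.
  by apply: inj_comp rev_ord_inj; apply: can_inj (f_invF _).
have -> : dominant u = [seq u (h p) | p <- enum 'I_n].
  apply: (@sorted_eq _ geq).
  - by move=> a b c ba ac; exact: leq_trans ac ba.
  - by move=> a b /andP[ab ba]; apply/eqP; rewrite eqn_leq; apply/andP.
  - by apply: sort_sorted => a b; rewrite leq_total.
  - apply/(sortedP 0%N) => p; rewrite size_map size_enum_ord => ltpn.
    have ltp := ltnW ltpn.
    rewrite !(nth_map (Ordinal ltp)) -?enumT ?size_enum_ord //.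
    apply: (@rank_le_parts u).
    have hE x : spectral_exp u (h x) = rev_ord x.
      by rewrite -[LHS]/(nat_of_ord (rank_ord u (h x))) f_invF.
    by rewrite !hE /= !nth_enum_ord //; lia.
  - rewrite (perm_trans (permEl (perm_sort _ _))) // codomE.
    rewrite (map_comp u h); apply: perm_map; apply: uniq_perm.
    + exact: enum_uniq.
    + by rewrite map_inj_uniq ?enum_uniq.
    + move=> p; rewrite mem_enum; apply/esym/mapP; exists (invF h_inj p).
        by rewrite mem_enum.
      by rewrite f_invF.
rewrite (nth_map i) ?size_enum_ord // nth_ord_enum.
by rewrite /h rev_ordK invF_f.
Qed.

Lemma qpoch_comp_rank (A : comUnitRingType) (q t b : A) u :
  qpoch_comp q t b u =
  \prod_(i < n) qpoch q (b * t ^- (n - (spectral_exp u i).+1)) (u i).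
Proof.
rewrite /qpoch_comp (reindex (fun i => rev_ord (rank_ord u i))) /=.
  by apply: eq_bigr => i _; rewrite (nth_dominant u i).
by apply: onW_bij; apply: injF_bij; apply: inj_comp rev_ord_inj (@rank_ord_inj u).
Qed.

(* The parts of the conjugate partition of u^+. *)
Definition nparts u m := #|[pred i | (m < u i)%N]|.

(** The indices with u_i > m are the [nparts u m] indices of highest rank. *)
Lemma rank_nparts u i m : (n <= spectral_exp u i + nparts u m)%N = (m < u i)%N.
Proof.
have cn : #|'I_n| = n by rewrite card_ord.
case: ltnP => [ltm|lem].
  rewrite -[X in (X <= _)%N]cn spectral_expE -(cardC [pred j | below u j i]).
  rewrite leq_add2l; apply: subset_leq_card; apply/fintype.subsetP => j.
  by rewrite !inE /below; lia.
apply/negbTE; rewrite -ltnNge -[X in (_ < X)%N]cn spectral_expE /nparts -cardUI.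
rewrite [X in (_ + X)%N]eq_card0 ?addn0; last first.
  by move=> j; rewrite !inE /below; lia.
apply: proper_card; apply/properP; split; first exact/fintype.subsetP.
by exists i; rewrite // !inE below_irr; lia.
Qed.

(** The right-hand side sees u only through the conjugate of u^+, so the products for v and w can be
    compared when v^+ is contained in w^+. *)
Lemma prod_rank (A : comNzRingType) (F : nat -> nat -> A) u M :
  (forall i, u i <= M)%N ->
  \prod_(i < n) \prod_(m < u i) F (spectral_exp u i) m =
  \prod_(k < n) \prod_(m < M | (n <= k + nparts u m)%N) F k m.
Proof.
move=> uM; rewrite [RHS](reindex_inj (@rank_ord_inj u)) /=.
apply: eq_bigr => i _; rewrite (big_ord_widen _ _ (uM i)).
by apply: eq_bigl => m; rewrite rank_nparts.
Qed.

End Rank.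

(** * Legs as cardinals of one set of rows *)

Section LegStatistics.
Variable n : nat.
Implicit Types (u : multinom n) (i j k : 'I_n).

Definition in_leg u i c k :=
  ((i < k)%N && (c <= u k <= u i)%N) || ((k < i)%N && (c <= (u k).+1 <= u i)%N).

Lemma legE u i c : leg u i c = #|[pred k | in_leg u i c k]|.
Proof.
rewrite /leg -cardUI [X in (_ + X)%N]eq_card0 ?addn0; last first.
  by move=> k; rewrite !inE; lia.
by apply: eq_card => k; rewrite !inE.
Qed.

(** The exponent of t in the leading coefficient of S_u. *)
Definition rank_weight u := (\sum_(i < n) spectral_exp u i * u i)%N.

End LegStatistics.

(** * The affine rotation of compositions *)

Section RotateComposition.
Variable n : nat.
Implicit Types (u : multinom n.+1) (i j k : 'I_n.+1).

Definition rotc u : multinom n.+1 :=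
  Multinom [tuple (u (ordS i) + (i == ord_max))%N | i < n.+1].

Lemma rotcE u i : rotc u i = (u (ordS i) + (i == ord_max))%N.
Proof. exact: mnmE. Qed.

Lemma ordS_val i : ordS i = (if i == ord_max then 0 else i.+1)%N :> nat.
Proof.
rewrite /ordS /= -val_eqE /=; have := ltn_ord i; rewrite ltnS leq_eqVlt.
case: eqP => [->|_] /=; first by rewrite modnn.
by move=> ltin; rewrite modn_small.
Qed.

Lemma ordS_max : ordS (ord_max : 'I_n.+1) = ord0.
Proof. by apply/val_inj; rewrite /= modnn. Qed.

Lemma ord_max_val i : (i == ord_max) = (i == n :> nat).
Proof. by []. Qed.

Lemma below_rotc u i j : below (rotc u) j i = below u (ordS j) (ordS i).
Proof.
rewrite /below !rotcE !ordS_val !ord_max_val.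
have := ltn_ord i; have := ltn_ord j; rewrite !ltnS.
have [ei|] := eqVneq (i : nat) n; have [ej|] := eqVneq (j : nat) n => /=; lia.
Qed.

Lemma rank_rotc u i : spectral_exp (rotc u) i = spectral_exp u (ordS i).
Proof.
rewrite !spectral_expE -!sum1_card [RHS](reindex_inj (@ordS_inj _)) /=.
by apply: eq_bigl => j; rewrite !inE below_rotc.
Qed.

Lemma mdeg_rotc u : mdeg (rotc u) = (mdeg u).+1.
Proof.
rewrite !mdegE (eq_bigr _ (fun i _ => rotcE u i)) big_split /= addnC.
rewrite [in RHS](reindex_inj (@ordS_inj n.+1)) /= -[RHS]add1n.
congr (_ + _)%N; rewrite (bigD1 ord_max) //= eqxx big1 // => i.
by move/negbTE->.
Qed.

Lemma rotc_inj : injective rotc.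
Proof.
move=> u v /mnmP uv; apply/mnmP => i.
have := uv (ord_pred i); rewrite !rotcE ord_predK => /eqP.
by rewrite eqn_add2r => /eqP.
Qed.

Lemma rotc_surj u : (0 < u ord_max)%N -> exists v, u = rotc v.
Proof.
move=> u_gt0; exists (Multinom [tuple (u (ord_pred i) - (i == ord0))%N | i < n.+1]).
apply/mnmP => i; rewrite rotcE mnmE ordSK.
have -> : (ordS i == ord0) = (i == ord_max).
  by rewrite -ordS_max (inj_eq (@ordS_inj _)).
by case: eqP => [->|_]; rewrite /= ?subn0 ?addn0 // subnK.
Qed.

Lemma in_leg_rotc u i c k : i != ord_max ->
  in_leg (rotc u) i c k = in_leg u (ordS i) c (ordS k).
Proof.
rewrite /in_leg !rotcE !ordS_val !ord_max_val => ni; rewrite (negbTE ni).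
have := ltn_ord i; have := ltn_ord k; rewrite !ltnS.
have [ek|] := eqVneq (k : nat) n => /=; lia.
Qed.

Lemma in_leg_rotc_max u c k :
  in_leg (rotc u) ord_max c.+2 k = in_leg u (ordS ord_max) c.+1 (ordS k).
Proof.
rewrite /in_leg !rotcE !ordS_val !ord_max_val /= eqxx.
have := ltn_ord k; rewrite !ltnS.
have [ek|] := eqVneq (k : nat) n => /=; lia.
Qed.

Lemma leg_rotc u i c : i != ord_max -> leg (rotc u) i c = leg u (ordS i) c.
Proof.
move=> ni; rewrite !legE -!sum1_card [RHS](reindex_inj (@ordS_inj _)) /=.
by apply: eq_bigl => j; rewrite !inE in_leg_rotc.
Qed.

Lemma leg_rotc_max u c :
  leg (rotc u) ord_max c.+2 = leg u (ordS ord_max) c.+1.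
Proof.
rewrite !legE -!sum1_card [RHS](reindex_inj (@ordS_inj _)) /=.
by apply: eq_bigl => j; rewrite !inE in_leg_rotc_max.
Qed.

(** In the first column of the last row the lower bound on earlier parts is void; what remains is
    the rows of u other than the first with u_k <= u_1, which are the rows below the first. *)
Lemma leg_rotc_max1 u :
  leg (rotc u) ord_max 1 = spectral_exp u (ordS ord_max).
Proof.
rewrite legE spectral_expE -!sum1_card [RHS](reindex_inj (@ordS_inj _)) /=.
apply: eq_bigl => k; rewrite !inE /in_leg /below !rotcE !ordS_val !eqxx.
have := ltn_ord k; rewrite !ltnS; case: eqVneq => [->|].
  by rewrite !ltnn eqxx /=.
by rewrite -val_eqE /=; lia.
Qed.

(* Squares of u and of its rotation correspond, up to the new square, which is
   the first one of the last row; big_rotc says so for any additive or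
   multiplicative statistic of arm and leg. *)
Lemma big_rotc (T : Type) (idx : T) (op : Monoid.com_law idx)
    (F : nat -> nat -> T) u :
  \big[op/idx]_(i < n.+1) \big[op/idx]_(1 <= c < (rotc u i).+1)
     F (rotc u i - c)%N (leg (rotc u) i c) =
  op (F (u ord0) (spectral_exp u ord0))
     (\big[op/idx]_(i < n.+1) \big[op/idx]_(1 <= c < (u i).+1)
        F (u i - c)%N (leg u i c)).
Proof.
rewrite [in RHS](reindex_inj (@ordS_inj n.+1)) /=.
rewrite (bigD1 ord_max) //= [in RHS](bigD1 ord_max) //= Monoid.mulmA.
congr (op _ _); last first.
  apply: eq_bigr => i ni; rewrite rotcE (negbTE ni) addn0.
  by apply: eq_bigr => c _; rewrite leg_rotc.
rewrite rotcE eqxx addn1 big_ltn // leg_rotc_max1 subn1 /= ordS_max.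
congr (op _ _); rewrite big_add1 /= !big_nat; apply: eq_bigr => -[//|c] _.
by rewrite leg_rotc_max ordS_max subSS.
Qed.

Lemma nstat_rotc u : nstat (rotc u) = (spectral_exp u ord0 + nstat u)%N.
Proof. exact: (@big_rotc _ _ addn (fun _ l => l)). Qed.

Lemma cprime_rotc (K : fieldType) (q t : K) u :
  cprime q t (rotc u) =
  (1 - q ^+ (u ord0).+1 * t ^+ spectral_exp u ord0) * cprime q t u.
Proof. exact: (@big_rotc _ _ *%R (fun a l => 1 - q ^+ a.+1 * t ^+ l)). Qed.

Lemma nstat'_rotc u : nstat' (rotc u) = (u ord0 + nstat' u)%N.
Proof.
rewrite /nstat' [in RHS](reindex_inj (@ordS_inj n.+1)) /=.
rewrite (bigD1 ord_max) //= [in RHS](bigD1 ord_max) //= addnA.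
congr (_ + _)%N; last first.
  by apply: eq_bigr => i ni; rewrite rotcE (negbTE ni) addn0.
by rewrite rotcE eqxx addn1 binS bin1 ordS_max addnC.
Qed.

Lemma rank_weight_rotc u :
  rank_weight (rotc u) = (spectral_exp u ord0 + rank_weight u)%N.
Proof.
rewrite /rank_weight [in RHS](reindex_inj (@ordS_inj n.+1)) /=.
rewrite (bigD1 ord_max) //= [in RHS](bigD1 ord_max) //= addnA.
congr (_ + _)%N; last first.
  by apply: eq_bigr => i ni; rewrite rank_rotc rotcE (negbTE ni) addn0.
by rewrite rank_rotc rotcE eqxx addn1 mulnS ordS_max.
Qed.

Lemma nparts_rotc u m : (nparts u m <= nparts (rotc u) m)%N.
Proof.
rewrite /nparts -!sum1_card (reindex_inj (@ordS_inj n.+1)) /= !sum1_card.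
apply: subset_leq_card; apply/fintype.subsetP => i; rewrite !inE rotcE.
by move/leq_trans; apply; rewrite leq_addr.
Qed.

End RotateComposition.

(** * Exchange of two adjacent parts *)

Section SwapComposition.
Variables (n : nat) (i j : 'I_n).
Hypothesis ij : j = i.+1 :> nat.
Implicit Types (u : multinom n) (a b k : 'I_n).

Definition swapc u : multinom n := Multinom [tuple u (tperm i j k) | k < n].

Lemma swapcE u k : swapc u k = u (tperm i j k).
Proof. exact: mnmE. Qed.

Lemma swapcK : involutive swapc.
Proof. by move=> u; apply/mnmP => k; rewrite !swapcE tpermK. Qed.

Lemma tperm_val k : tperm i j k =
  (if k == i :> nat then j else if k == j :> nat then i else k) :> nat.
Proof.
case: tpermP => [->|->|/eqP nki /eqP nkj]; first by rewrite eqxx.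
  by rewrite eqxx; case: eqP => // /val_inj ->.
by move: nki nkj; rewrite -!val_eqE /= => /negbTE -> /negbTE ->.
Qed.

Lemma mdeg_swapc u : mdeg (swapc u) = mdeg u.
Proof.
rewrite !mdegE [RHS](reindex_inj (@perm_inj _ (tperm i j))) /=.
by apply: eq_bigr => k _; rewrite swapcE.
Qed.

Lemma nparts_swapc u m : nparts (swapc u) m = nparts u m.
Proof.
rewrite /nparts -!sum1_card [RHS](reindex_inj (@perm_inj _ (tperm i j))) /=.
by apply: eq_bigl => k; rewrite !inE swapcE.
Qed.

Lemma nstat'_swapc u : nstat' (swapc u) = nstat' u.
Proof.
rewrite /nstat' [RHS](reindex_inj (@perm_inj _ (tperm i j))) /=.
by apply: eq_bigr => k _; rewrite swapcE.
Qed.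

(** The transposition alters the relative position of i and j only, and these two are not tied. *)
Lemma below_swapc u a b : u i != u j ->
  below (swapc u) a b = below u (tperm i j a) (tperm i j b).
Proof.
move=> nij; rewrite /below !swapcE.
have := tperm_val a; have := tperm_val b.
do 2 case: tpermP => [->|->|/eqP + /eqP +]; rewrite -?val_eqE /=; lia.
Qed.

Lemma rank_swapc u a : u i != u j ->
  spectral_exp (swapc u) a = spectral_exp u (tperm i j a).
Proof.
move=> nij; rewrite !spectral_expE -!sum1_card.
rewrite [RHS](reindex_inj (@perm_inj _ (tperm i j))) /=.
by apply: eq_bigl => k; rewrite !inE below_swapc.
Qed.

Lemma rank_weight_swapc u : u i != u j ->
  rank_weight (swapc u) = rank_weight u.
Proof.
move=> nij; rewrite /rank_weight.
rewrite [RHS](reindex_inj (@perm_inj _ (tperm i j))) /=.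
by apply: eq_bigr => k _; rewrite swapcE rank_swapc.
Qed.

(** No index lies strictly between j and i in the order [below u]. *)
Lemma rank_adjacent u : u i = u j -> spectral_exp u i = (spectral_exp u j).+1.
Proof.
move=> uij; rewrite !spectral_expE.
rewrite -add1n -[1%N](card1 j) -cardUI [X in (_ + X)%N]eq_card0 ?addn0.
  apply: eq_card => k; rewrite !inE /below; case: (eqVneq k j) => [->|].
    by lia.
  by rewrite -val_eqE /=; lia.
by move=> k; rewrite !inE /below; case: (eqVneq k j) => [->|] //; lia.
Qed.

Section ZeroFirst.
Variable u : multinom n.
Hypotheses (ui0 : u i = 0%N) (uj_gt0 : (0 < u j)%N).

Lemma leg_swapc a c : a != i -> a != j ->
  leg (swapc u) a c = leg u (tperm i j a) c.
Proof.
move=> nai naj; rewrite !legE -!sum1_card.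
rewrite [RHS](reindex_inj (@perm_inj _ (tperm i j))) /=.
apply: eq_bigl => k; rewrite !inE /in_leg !swapcE.
have := tperm_val k; have := tperm_val a.
case: (tpermP i j k) => [->|->|/eqP + /eqP +];
  case: tpermP nai naj => [->|->|/eqP + /eqP +]; rewrite -?val_eqE /=; lia.
Qed.

Lemma leg_swapc_above c : leg (swapc u) i c.+2 = leg u j c.+2.
Proof.
rewrite !legE -!sum1_card.
rewrite [RHS](reindex_inj (@perm_inj _ (tperm i j))) /=.
apply: eq_bigl => k; rewrite !inE /in_leg !swapcE tpermL.
have := tperm_val k.
case: (tpermP i j k) => [->|->|/eqP + /eqP +]; rewrite -?val_eqE /=; lia.
Qed.

(** The zero row counts in the leg of the first square when it comes earlier, through u_k + 1, but
    not when it comes later. *)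
Lemma leg_swapc_first : (leg (swapc u) i 1).+1 = leg u j 1.
Proof.
rewrite !legE -!sum1_card [RHS](reindex_inj (@perm_inj _ (tperm i j))) /=.
rewrite !sum1_card -[LHS]add1n -[X in (X + _)%N](card1 j) -cardUI.
rewrite [X in (_ + X)%N]eq_card0 ?addn0.
  apply: eq_card => k; rewrite !inE unfold_in /= /in_leg !swapcE tpermL.
  have := tperm_val k; case: (eqVneq k j) => [->|]; first by rewrite tpermR; lia.
  by case: (tpermP i j k) => [->|->|/eqP + /eqP +]; rewrite -?val_eqE /=; lia.
move=> k; rewrite !inE /in_leg !swapcE tpermL.
by case: (eqVneq k j) => [->|] //; rewrite tpermR; lia.
Qed.

(** Of the rows below j, the zero rows after j are those below i; the others form the leg. This
    gives the ratio of the spectral entries at j and i. *)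
Lemma rank_leg : spectral_exp u j = (spectral_exp u i + leg u j 1)%N.
Proof.
rewrite !spectral_expE legE -cardUI [X in (_ + X)%N]eq_card0 ?addn0.
  apply: eq_card => k; rewrite !inE /in_leg /below.
  case: (ltngtP (k : nat) j) => [||/val_inj ->]; lia.
by move=> k; rewrite !inE /in_leg /below; lia.
Qed.

(** Squares correspond with the same arm and leg, except the first one of the moved row, whose leg
    drops by one. The extra factor on each side replaces a division, which a monoid does not
    offer. *)
Lemma big_swapc (T : Type) (idx : T) (op : Monoid.com_law idx)
    (F : nat -> nat -> T) :
  op (F (u j).-1 (leg u j 1))
  (\big[op/idx]_(a < n) \big[op/idx]_(1 <= c < (swapc u a).+1)
     F (swapc u a - c)%N (leg (swapc u) a c)) =
  op (F (u j).-1 (leg u j 1).-1)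
     (\big[op/idx]_(a < n) \big[op/idx]_(1 <= c < (u a).+1)
        F (u a - c)%N (leg u a c)).
Proof.
have nij : i != j by rewrite -val_eqE /= ij; lia.
rewrite (bigD1 i) //= (bigD1 j) //= 1?eq_sym //.
rewrite [in RHS](bigD1 i) //= [in RHS](bigD1 j) //= 1?eq_sym //.
rewrite !swapcE tpermL tpermR ui0 !(big_geq (leqnn 1)) !Monoid.mul1m.
rewrite !Monoid.mulmA; congr (op _ _); last first.
  apply: eq_bigr => a /andP[nai naj]; rewrite swapcE tpermD 1?eq_sym //.
  by apply: eq_bigr => c _; rewrite leg_swapc // tpermD 1?eq_sym.
rewrite big_ltn ?ltnS // [in RHS]big_ltn ?ltnS // -leg_swapc_first /= subn1.
rewrite !Monoid.mulmA; congr (op _ _); first exact: Monoid.mulmC.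
rewrite !big_nat; apply: eq_bigr => -[|[|c]] //.
by rewrite leg_swapc_above.
Qed.

Lemma nstat_swapc : (nstat (swapc u)).+1 = nstat u.
Proof.
have : (leg u j 1 + nstat (swapc u) = (leg u j 1).-1 + nstat u)%N.
  exact: (@big_swapc _ _ addn (fun _ l => l)).
by have := leg_swapc_first; lia.
Qed.

Lemma cprime_swapc (K : fieldType) (q t : K) :
  (1 - q ^+ u j * t ^+ leg u j 1) * cprime q t (swapc u) =
  (1 - q ^+ u j * t ^+ (leg u j 1).-1) * cprime q t u.
Proof.
have := @big_swapc _ _ *%R (fun r l => 1 - q ^+ r.+1 * t ^+ l : K).
by rewrite prednK.
Qed.

End ZeroFirst.
End SwapComposition.
(** * The Bruhat order on compositions *)

Section WeightOrder.
Variable n : nat.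
Implicit Types u v w m : multinom n.

(* Bruhat order on compositions, seen as periodic sequences u_(k + n) = u_k - 1:
   wt i c u counts the pairs (k, r) with k < i (in the periodic sequence) and
   c <= r < u_k. *)
Definition wt (i c : nat) u := (\sum_(k < n) (u k - (c + (i <= k))))%N.

Definition lew v u := forall i c, (wt i c v <= wt i c u)%N.

Lemma lew_trans u v w : lew u v -> lew v w -> lew u w.
Proof. by move=> uv vw i c; exact: leq_trans (uv i c) (vw i c). Qed.

Lemma lem_lew v u : (forall k, (v k <= u k)%N) -> lew v u.
Proof. by move=> vu i c; apply: leq_sum => k _; apply: leq_sub2r. Qed.

Lemma wt_mdeg u : wt n 0 u = mdeg u.
Proof.
by rewrite mdegE; apply: eq_bigr => k _; rewrite leqNgt ltn_ord subn0.
Qed.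

Lemma lew_mdeg v u : lew v u -> (mdeg v <= mdeg u)%N.
Proof. by move=> /(_ n 0%N); rewrite !wt_mdeg. Qed.

Lemma wtS u (i : 'I_n) c : wt i.+1 c u = (wt i c u + (c < u i))%N.
Proof.
rewrite /wt (bigD1 i) //= [in RHS](bigD1 i) //= ltnn leqnn.
rewrite (eq_bigr (fun k => u k - (c + (i <= k)))%N); first lia.
by move=> k; rewrite -val_eqE ltn_neqAle eq_sym => /= /negbTE ->.
Qed.

Lemma mnm_le_mdeg u (i : 'I_n) : (u i <= mdeg u)%N.
Proof. by rewrite mdegE (bigD1 i) //= leq_addr. Qed.

(** A measure for induction along [lew] on compositions of degree less than M. *)
Definition wt_total M u := (\sum_(p : 'I_n.+1 * 'I_M) wt p.1 p.2 u)%N.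

(** Equal totals force all weights to agree, and consecutive weights differ by [c < u_i], which for
    c < M determines the parts. *)
Lemma lew_lt_total M v u :
  (mdeg v < M)%N -> (mdeg u < M)%N -> lew v u -> v != u ->
  (wt_total M v < wt_total M u)%N.
Proof.
move=> vM uM vu nvu.
have [le_t eq_t] := @leqif_sum _ xpredT
  (fun p : 'I_n.+1 * 'I_M => wt p.1 p.2 v == wt p.1 p.2 u)
  (fun p => wt p.1 p.2 v) (fun p => wt p.1 p.2 u)
  (fun p _ => leqif_eq (vu p.1 p.2)).
rewrite ltn_neqAle le_t andbT; apply: contraNneq nvu => /eqP.
rewrite eq_t => /forallP /= eq_wt; apply/eqP/mnmP => i.
have eqM c : (c < M)%N -> (c < v i)%N = (c < u i)%N.
  move=> cM.
  have i_lt : (i < n.+1)%N by apply: ltnW; rewrite ltnS ltn_ord.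
  have iS_lt : (i.+1 < n.+1)%N by rewrite ltnS ltn_ord.
  have /eqP /= := eq_wt (Ordinal i_lt, Ordinal cM).
  have /eqP /= := eq_wt (Ordinal iS_lt, Ordinal cM).
  by rewrite !wtS; lia.
have := mnm_le_mdeg u i; have := mnm_le_mdeg v i.
by have := eqM (u i); have := eqM (v i); lia.
Qed.

Section Swap.
Variables i j : 'I_n.
Hypothesis ij : j = i.+1 :> nat.

Lemma wt_split a c u : wt a c u =
  (u i - (c + (a <= i)) + (u j - (c + (a <= j)))
   + \sum_(k < n | (k != i) && (k != j)) (u k - (c + (a <= k))))%N.
Proof.
have nji : j != i by rewrite -val_eqE /= ij; lia.
by rewrite /wt (bigD1 i) //= (bigD1 j) //= addnA.
Qed.

(** For a != j the weight [wt a c] treats positions i and j alike and is convex in the two parts, so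
    fixing their sum and bounding their maximum cannot increase it. For a = j the bound is
    [wt j.+1 c u], which equals [wt j c] of the swapped composition because u_i = 0. *)
Lemma lew_swapc u v m :
  u i = 0%N -> (0 < u j)%N -> lew v u ->
  (forall k, k != i -> k != j -> m k = v k) ->
  (m i + m j = v i + v j)%N -> (maxn (m i) (m j) <= maxn (v i) (v j))%N ->
  lew m (swapc i j u).
Proof.
move=> ui0 uj_gt0 vu mv sum_eq max_le a c.
have nij : i != j by rewrite -val_eqE /= ij; lia.
have rest b a' (eqa : forall k, k != i -> k != j -> (b <= k)%N = (a' <= k)%N)
    (x y : multinom n) (xy : forall k, k != i -> k != j -> x k = y k) :
    (\sum_(k < n | (k != i) && (k != j)) (x k - (c + (b <= k))) =
     \sum_(k < n | (k != i) && (k != j)) (y k - (c + (a' <= k))))%N.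
  by apply: eq_bigr => k /andP[ki kj]; rewrite xy // eqa.
rewrite !wt_split !swapcE tpermL tpermR ui0.
have su k : k != i -> k != j -> swapc i j u k = u k.
  by move=> ki kj; rewrite swapcE tpermD 1?eq_sym.
case: (eqVneq a j) => [->|naj].
  have eqa k : k != i -> k != j -> (j <= k)%N = (j.+1 <= k)%N.
    by rewrite -!val_eqE /=; lia.
  have := vu j.+1 c; rewrite !wt_split ui0.
  rewrite (rest _ _ eqa _ _ mv) (rest _ _ eqa _ _ su) ij; lia.
have := vu a c; rewrite !wt_split ui0.
rewrite (rest a a _ _ _ mv) // (rest a a _ _ _ su) //; lia.
Qed.

Lemma lew_swapc_id u v :
  u i = 0%N -> (0 < u j)%N -> lew v u -> lew v (swapc i j u).
Proof. by move=> ui0 uj_gt0 vu; exact: (lew_swapc ui0 uj_gt0 vu). Qed.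

(** At threshold j the nonzero part counts in full at position i but loses one at position j. Hence
    the monomial of [swapc i j u] is absent from M_u. *)
Lemma lew_swapcN u : u i = 0%N -> (0 < u j)%N -> ~ lew (swapc i j u) u.
Proof.
move=> ui0 uj_gt0 /(_ j 0%N); rewrite !wt_split !swapcE tpermL tpermR ui0.
rewrite (eq_bigr (fun k => u k - (0 + (j <= k)))%N) => [|k /andP[ki kj]].
  by rewrite leq_add2r ij ltnn leqnn; lia.
by rewrite swapcE tpermD 1?eq_sym.
Qed.

End Swap.
End WeightOrder.

(** * Rotation and the Bruhat order *)

Section WeightOrderRotate.
Variable n : nat.
Implicit Types u v : multinom n.+1.

(** Rotation shifts the periodic sequence by one place; a threshold beyond the last position
    re-enters at the start with c lowered by one, and for c = 0 the weight is the total degree. *)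
Lemma wt_rotc i c u : wt i c (rotc u) =
  if (i <= n)%N then wt i.+1 c u
  else if c is c'.+1 then wt 1 c' u else (mdeg u).+1.
Proof.
have split_max a b x : wt a b x =
    (x (ordS ord_max) - (b + (a <= 0)) +
     \sum_(k < n.+1 | k != ord_max) (x (ordS k) - (b + (a <= k.+1))))%N.
  rewrite /wt (reindex_inj (@ordS_inj n.+1)) /= (bigD1 ord_max) //=.
  rewrite modnn; congr (_ + _)%N; apply: eq_bigr => k nk.
  by rewrite -[(k.+1 %% n.+1)%N]/(ordS k : nat) ordS_val (negbTE nk).
have -> : wt i c (rotc u) =
    (u (ordS ord_max) + 1 - (c + (i <= n)) +
     \sum_(k < n.+1 | k != ord_max) (u (ordS k) - (c + (i <= k))))%N.
  rewrite /wt (bigD1 ord_max) //= rotcE eqxx; congr (_ + _)%N.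
  by apply: eq_bigr => k nk; rewrite rotcE (negbTE nk) addn0.
case: leqP => [le_in|lt_ni]; first by rewrite split_max /=; congr (_ + _)%N; lia.
have ltk (k : 'I_n.+1) : (i <= k)%N = false by have := ltn_ord k; lia.
case: c => [|c].
  rewrite -wt_mdeg split_max /= -addSn; congr (_ + _)%N; first lia.
  apply: eq_bigr => k nk; have := ltn_ord k; move: nk.
  by rewrite ltk -val_eqE /=; lia.
rewrite split_max /=; congr (_ + _)%N; first lia.
by apply: eq_bigr => k _; rewrite ltk addn0 addn1.
Qed.

Lemma lew_rotc v u : lew v u -> lew (rotc v) (rotc u).
Proof.
move=> vu i c; rewrite !wt_rotc; case: ifP => // _; case: c => // .
exact: lew_mdeg vu.
Qed.

End WeightOrderRotate.
(** * Affine rotation and exchange operators *)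

Section MonomialwiseMap.
Variables (K : fieldType) (n : nat).
Implicit Types (f p : mpoly n K) (m a : multinom n) (D : multinom n -> mpoly n K).

Definition mlin D f : mpoly n K := \sum_(m <- msupp f) mcoeff m f *: D m.

Lemma meval_mlin x D f :
  meval x (mlin D f) = \sum_(m <- msupp f) mcoeff m f * meval x (D m).
Proof. by rewrite raddf_sum; apply: eq_bigr => m _ /=; rewrite mevalZ. Qed.

Lemma mcoeff_mlin a D f :
  mcoeff a (mlin D f) = \sum_(m <- msupp f) mcoeff m f * mcoeff a (D m).
Proof. by rewrite raddf_sum; apply: eq_bigr => m _ /=; rewrite mcoeffZ. Qed.

Lemma mcoeff_mlin1 a m0 D f : (m0 \in msupp f -> mcoeff a (D m0) = 1) ->
  (forall m, m \in msupp f -> m != m0 -> mcoeff a (D m) = 0) ->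
  mcoeff a (mlin D f) = mcoeff m0 f.
Proof.
move=> D1 D0; rewrite mcoeff_mlin; case: (boolP (m0 \in msupp f)) => m0f.
  rewrite (bigD1_seq m0) ?msupp_uniq //= D1 // mulr1 big_seq_cond big1 ?addr0 //.
  by move=> m /andP[mf nm]; rewrite D0 // mulr0.
rewrite (memN_msupp_eq0 m0f) big_seq big1 // => m mf.
by rewrite D0 ?mulr0 //; apply: contraNneq m0f => <-.
Qed.

Lemma msupp_mlin a D f :
  a \in msupp (mlin D f) -> exists2 m, m \in msupp f & a \in msupp (D m).
Proof.
rewrite mcoeff_msupp mcoeff_mlin => nz.
have [[m mf am]|none] := @hasP _ (fun m => a \in msupp (D m)) (msupp f).
  by exists m.
exfalso; move: nz; rewrite big_seq big1 ?eqxx // => m mf.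
rewrite (@memN_msupp_eq0 _ _ (D m)) ?mulr0 //.
by apply/negP => am; apply: none; exists m.
Qed.

End MonomialwiseMap.

(** * Spectral vectors for generic q and t *)

Section SpectralVector.
Variables (K : fieldType) (q t : K).
Hypothesis gen : generic q t.

Lemma generic_q0 : q != 0. Proof. by case: gen. Qed.
Lemma generic_t0 : t != 0. Proof. by case: gen. Qed.

Lemma generic_inj (a b c d : nat) :
  q ^+ a * t ^+ b = q ^+ c * t ^+ d -> a = c /\ b = d.
Proof.
case: gen => q0 t0 h e.
have : q ^ (a%:Z - c%:Z) * t ^ (b%:Z - d%:Z) = 1.
  rewrite !expfzDr // -!invr_expz -!exprnP mulrACA e -invfM mulfV //.
  by rewrite mulf_neq0 ?expf_neq0.
by move/h => [/eqP + /eqP]; rewrite !subr_eq0 => /eqP[->] /eqP[->].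
Qed.

Lemma generic_neq1 (a b : nat) : (0 < a)%N -> 1 - q ^+ a * t ^+ b != 0.
Proof.
move=> a_gt0; rewrite subr_eq0; apply: contraTneq a_gt0 => e.
have := @generic_inj 0 0 a b; rewrite !expr0 mul1r => /(_ e) [<-].
by rewrite ltnn.
Qed.

Variable n : nat.
Implicit Types (u v w : multinom n) (i j k : 'I_n).

Local Notation sp := (spectral q t).

Lemma spectralE u i : sp u i = q ^+ u i * t ^+ spectral_exp u i.
Proof. by []. Qed.

Lemma spectral_neq0 u i : sp u i != 0.
Proof. by rewrite mulf_neq0 ?expf_neq0 ?generic_q0 ?generic_t0. Qed.

Lemma spectral_distinct u i j : i != j -> sp u i != sp u j.
Proof. by apply: contraNneq => /generic_inj[_ /rank_inj ->]. Qed.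

Lemma spectral_eq u v : sp u =1 sp v -> u = v.
Proof. by move=> uv; apply/mnmP => i; have /generic_inj[] := uv i. Qed.

Lemma spectral_swapc u i j : j = i.+1 :> nat -> u i != u j ->
  sp (swapc i j u) =1 (fun k => sp u (tperm i j k)).
Proof. by move=> ij nij k; rewrite !spectralE swapcE rank_swapc. Qed.

(** This is where the factor x_i - t x_j of the exchange operator vanishes. *)
Lemma spectral_adjacent u i j : j = i.+1 :> nat -> u i = u j ->
  sp u i = t * sp u j.
Proof. by move=> ij uij; rewrite !spectralE (rank_adjacent ij) // uij exprS; ring. Qed.

Lemma cprime_neq0 u : cprime q t u != 0.
Proof.
apply/prodf_neq0 => i _; rewrite prodf_seq_neq0; apply/allP => c _ /=.
exact: generic_neq1.
Qed.

End SpectralVector.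

(** * The raising operator *)

Section RotationOperator.
Variables (K : fieldType) (n : nat) (q : K).
Implicit Types (f : mpoly n.+1 K) (m u : multinom n.+1) (x : 'I_n.+1 -> K).

Definition mnm_rot m : multinom n.+1 := Multinom [tuple m (ordS i) | i < n.+1].

Lemma mnm_rotE m i : mnm_rot m i = m (ordS i).
Proof. exact: mnmE. Qed.

(** The Knop-Sahi operator sending f to (x_n - 1) f(x_n / q, x_1, ..., x_(n-1)), with x_n the last
    variable; it is given on monomials so that supports can be read off. *)
Definition phi f : mpoly n.+1 K :=
  mlin (fun m => q ^- m ord0 *: (mpolyX K (rotc m) - mpolyX K (mnm_rot m))) f.

Definition rotx x (i : 'I_n.+1) : K :=
  x (ord_pred i) / (if i == ord0 then q else 1).

Lemma meval_phi x f : meval x (phi f) = (x ord_max - 1) * meval (rotx x) f.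
Proof.
rewrite meval_mlin mevalE mulr_sumr; apply: eq_bigr => m _.
rewrite mevalZ mevalB !mevalX [RHS]mulrCA; congr (_ * _).
have -> : \prod_(i < n.+1) rotx x i ^+ m i =
          q ^- m ord0 * \prod_(i < n.+1) x i ^+ mnm_rot m i.
  under eq_bigr => i _ do rewrite exprMn exprVn.
  rewrite big_split /= mulrC; congr (_ * _).
    rewrite (bigD1 ord0) //= big1 ?mulr1 // => i /negbTE ->.
    by rewrite expr1n invr1.
  rewrite (reindex_inj (@ordS_inj n.+1)) /=; apply: eq_bigr => i _.
  by rewrite ordSK mnm_rotE.
have -> : \prod_(i < n.+1) x i ^+ rotc m i =
          x ord_max * \prod_(i < n.+1) x i ^+ mnm_rot m i.
  under eq_bigr => i _ do rewrite rotcE exprD -mnm_rotE.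
  rewrite big_split /= mulrC; congr (_ * _).
  by rewrite (bigD1 ord_max) //= eqxx expr1 big1 ?mulr1 // => i /negbTE ->.
by ring.
Qed.

Lemma mnm_rot_lew m : lew (mnm_rot m) (rotc m).
Proof. by apply: lem_lew => i; rewrite mnm_rotE rotcE leq_addr. Qed.

Lemma msupp_phi a f : a \in msupp (phi f) ->
  exists2 m, m \in msupp f & lew a (rotc m).
Proof.
move/msupp_mlin => [m mf]; rewrite mcoeff_msupp mcoeffZ mcoeffB !mcoeffX => nz.
exists m => //; have [<- //|ne1] := eqVneq (rotc m) a.
have [<-|ne2] := eqVneq (mnm_rot m) a; first exact: mnm_rot_lew.
by move: nz; rewrite (negbTE ne1) (negbTE ne2) subrr mulr0 eqxx.
Qed.

Lemma mdeg_mnm_rot m : mdeg (mnm_rot m) = mdeg m.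
Proof.
rewrite !mdegE [RHS](reindex_inj (@ordS_inj n.+1)) /=.
by apply: eq_bigr => i _; rewrite mnm_rotE.
Qed.

Lemma mcoeff_phi u f : msize f = (mdeg u).+1 ->
  mcoeff (rotc u) (phi f) = q ^- u ord0 * mcoeff u f.
Proof.
move=> szf; rewrite mcoeff_mlin mulrC.
have D0 m : m \in msupp f -> mcoeff (rotc u)
    (q ^- m ord0 *: (mpolyX K (rotc m) - mpolyX K (mnm_rot m))) =
    q ^- u ord0 *+ (m == u).
  move=> /msize_mdeg_lt; rewrite szf => lt_mu.
  rewrite mcoeffZ mcoeffB !mcoeffX (inj_eq (@rotc_inj n)).
  have /negbTE -> : mnm_rot m != rotc u.
    apply: contraTneq lt_mu => /(congr1 (@mdeg _)).
    by rewrite mdeg_mnm_rot mdeg_rotc => ->; rewrite ltnn.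
  by case: eqP => [->|_]; rewrite subr0 ?mulr1 ?mulr0.
rewrite big_seq (eq_bigr _ (fun m mf => congr1 _ (D0 m mf))) -big_seq.
case: (boolP (u \in msupp f)) => uf.
  rewrite (bigD1_seq u) ?msupp_uniq //= eqxx big1 ?addr0 // => m /negbTE ->.
  by rewrite mulr0.
rewrite (memN_msupp_eq0 uf) mul0r big_seq big1 // => m mf.
by case: eqP uf => [<-|]; rewrite ?mf ?mulr0.
Qed.

End RotationOperator.

(** * The exchange operator *)

Section ExchangeOperator.
Variables (K : fieldType) (n : nat) (t : K) (i j : 'I_n).
Hypothesis nij : i != j.
Implicit Types (f : mpoly n K) (m u a : multinom n) (x : 'I_n -> K).

Definition setp m (p r : nat) : multinom n :=
  Multinom [tuple if k == i then p else if k == j then r else m k | k < n].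

Lemma setpE m p r k :
  setp m p r k = if k == i then p else if k == j then r else m k.
Proof. exact: mnmE. Qed.

(** The k-th term of (x_i - t x_j)(x_i^p x_j^r - x_i^r x_j^p) / (x_i - x_j), expanded as a geometric
    sum and multiplied by the other variables of x^m. *)
Definition exch_term m p r k : mpoly n K :=
  mpolyX K (setp m (p - k) (r + k)) - t *: mpolyX K (setp m (p - k.+1) (r + k.+1)).

Definition exch_mnm m : mpoly n K :=
  \sum_(k < m j - m i) exch_term m (m j) (m i) k
  - \sum_(k < m i - m j) exch_term m (m i) (m j) k.

(** The operator (x_i - t x_j) / (x_i - x_j) (s_ij - 1). In [exch_mnm] at least one of the two sums
    is empty, by truncated subtraction. *)
Definition exch f : mpoly n K := mlin exch_mnm f.

Definition swapx x (k : 'I_n) : K := x (tperm i j k).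

Lemma meval_setp x m p r : meval x (mpolyX K (setp m p r)) =
  x i ^+ p * x j ^+ r * \prod_(k < n | (k != i) && (k != j)) x k ^+ m k.
Proof.
rewrite mevalX (bigD1 i) //= (bigD1 j) 1?eq_sym //= mulrA !setpE !eqxx.
rewrite [j == i]eq_sym (negbTE nij); congr (_ * _).
by apply: eq_bigr => k /andP[/negbTE ki /negbTE kj]; rewrite setpE ki kj.
Qed.

Lemma setp_id m : setp m (m i) (m j) = m.
Proof. by apply/mnmP => k; rewrite setpE; do 2 case: eqP => [->|] //. Qed.

Lemma setp_swap m : setp m (m j) (m i) = swapc i j m.
Proof.
apply/mnmP => k; rewrite setpE swapcE; case: tpermP => [->|->|/eqP ki /eqP kj].
- by rewrite eqxx.
- by rewrite eq_sym (negbTE nij) eqxx.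
- by rewrite (negbTE ki) (negbTE kj).
Qed.

Lemma meval_swapx x m : meval (swapx x) (mpolyX K m) =
  meval x (mpolyX K (setp m (m j) (m i))).
Proof.
rewrite setp_swap !mevalX (reindex_inj (@perm_inj _ (tperm i j))) /=.
by apply: eq_bigr => k _; rewrite /swapx tpermK swapcE.
Qed.

Lemma meval_exch_term x m p r : (r <= p)%N ->
  (x i - x j) * meval x (\sum_(k < p - r) exch_term m p r k) =
  (x i - t * x j) *
  (meval x (mpolyX K (setp m p r)) - meval x (mpolyX K (setp m r p))).
Proof.
move=> le_rp; rewrite raddf_sum /= !meval_setp -mulrBl.
set P := \prod_(_ < _ | _) _.
have -> : x i ^+ p * x j ^+ r - x i ^+ r * x j ^+ p =
    x i ^+ r * x j ^+ r * (x i ^+ (p - r) - x j ^+ (p - r)).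
  rewrite -[p in LHS](subnK le_rp) !exprD; ring.
rewrite subrXX.
have -> : \sum_(k < p - r) meval x (exch_term m p r k) =
    (x i - t * x j) * (x i ^+ r * x j ^+ r) * P *
    \sum_(k < p - r) x i ^+ ((p - r).-1 - k) * x j ^+ k.
  rewrite mulr_sumr; apply: eq_bigr => k _; have ltk := ltn_ord k.
  rewrite mevalB mevalZ !meval_setp -/P.
  have -> : (p - k = ((p - r).-1 - k) + r + 1)%N by lia.
  have -> : (p - k.+1 = ((p - r).-1 - k) + r)%N by lia.
  have -> : (r + k.+1 = r + k + 1)%N by lia.
  by rewrite !exprD !expr1; ring.
by ring.
Qed.

Lemma meval_exch x f : x i != x j -> meval x (exch f) =
  (x i - t * x j) / (x i - x j) * (meval (swapx x) f - meval x f).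
Proof.
rewrite -subr_eq0 => nz; rewrite mulrAC; apply: (canRL (mulfK nz)).
have mE y : meval y f = \sum_(m <- msupp f) mcoeff m f * meval y (mpolyX K m).
  by rewrite mevalE; apply: eq_bigr => m _; rewrite mevalX.
rewrite meval_mlin !mE -sumrB mulr_sumr mulr_suml; apply: eq_bigr => m _.
rewrite -mulrBr mulrCA -mulrA; congr (_ * _).
rewrite mulrC meval_swapx -{5}(setp_id m) mevalB mulrBr.
have [le_ji|/ltnW le_ij] := leqP (m j) (m i).
  rewrite [X in _ - X]meval_exch_term //.
  have /eqP -> : (m j - m i == 0)%N by rewrite subn_eq0.
  by rewrite big_ord0 meval0; ring.
rewrite [X in X - _]meval_exch_term //.
have /eqP -> : (m i - m j == 0)%N by rewrite subn_eq0.
by rewrite big_ord0 meval0; ring.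
Qed.

Lemma mcoeff_exch_term a m p r k : mcoeff a (exch_term m p r k) =
  (setp m (p - k) (r + k) == a)%:R - t * (setp m (p - k.+1) (r + k.+1) == a)%:R.
Proof. by rewrite mcoeffB mcoeffZ !mcoeffX. Qed.

Lemma msupp_exch_mnm a m : a \in msupp (exch_mnm m) -> exists p r,
  [/\ a = setp m p r, (p + r = m i + m j)%N
    & (maxn p r <= maxn (m i) (m j))%N].
Proof.
move=> am; apply: contrapT => /forallNP none; move: am.
have term p r k : (k < p - r)%N -> (p = m i /\ r = m j \/ p = m j /\ r = m i) ->
    mcoeff a (exch_term m p r k) = 0.
  move=> ltk pr; rewrite mcoeff_exch_term.
  have nz p' r' : (p' + r' = m i + m j)%N ->
      (maxn p' r' <= maxn (m i) (m j))%N -> (setp m p' r' == a) = false.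
    by move=> e1 e2; apply/negP => /eqP ea; apply: (none p'); exists r'.
  by rewrite !nz ?subr0 ?mulr0 ?subr0 //; lia.
rewrite mcoeff_msupp mcoeffB !raddf_sum /=.
rewrite [X in X + _]big1 => [|k _]; last by apply: term => //; right.
rewrite big1 ?addr0 ?eqxx // => k _.
by rewrite term ?oppr0 //; left.
Qed.

(** The target monomial is free of x_j, which among the terms of [exch_mnm] only the first part of k
    = 0 can be; that one comes from x^u or from the target itself, and the latter is excluded by
    hypothesis. *)
Lemma mcoeff_exch u f : u i = 0%N -> (0 < u j)%N ->
  swapc i j u \notin msupp f ->
  mcoeff (swapc i j u) (exch f) = mcoeff u f.
Proof.
move=> ui0 uj_gt0 suf.
have si : swapc i j u i = u j by rewrite swapcE tpermL.
have sj : swapc i j u j = 0%N by rewrite swapcE tpermR.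
have sE m p r : setp m p r == swapc i j u ->
    [/\ p = u j, r = 0%N & forall k, k != i -> k != j -> m k = u k].
  move=> /eqP e; split.
  - by rewrite -si -e setpE eqxx.
  - by rewrite -sj -e setpE eqxx [j == i]eq_sym (negbTE nij).
  - move=> k ki kj; have := congr1 (fun a => a k) e.
    by rewrite setpE swapcE (negbTE ki) (negbTE kj) tpermD // eq_sym.
have nz m p r k : (setp m p (r + k.+1) == swapc i j u) = false.
  by apply/negP => /sE[_ /eqP]; rewrite addnS.
apply: mcoeff_mlin1 => [_|m mf nmu]; rewrite /exch_mnm.
  rewrite ui0 sub0n big_ord0 subr0 subn0 raddf_sum /= -(prednK uj_gt0).
  rewrite big_ord_recl /= big1 => [|k _]; rewrite mcoeff_exch_term nz mulr0 subr0.
    by rewrite subn0 prednK // addr0 -setp_swap ui0 eqxx.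
  by rewrite nz.
rewrite mcoeffB !raddf_sum /= !big1 ?addr0 // => k _; have ltk := ltn_ord k;
  rewrite mcoeff_exch_term nz mulr0 subr0;
  case: eqP => [/eqP/sE[e1 e2 e3]|_]; rewrite ?oppr0 //.
- have em : m = swapc i j u.
    apply/mnmP => l; rewrite swapcE; case: tpermP => [->|->|/eqP li /eqP lj].
    + lia.
    + lia.
    + exact: e3.
  by rewrite -em mf in suf.
- exfalso; case/eqP: nmu; apply/mnmP => l.
  have [->|li] := eqVneq l i; first lia.
  have [->|lj] := eqVneq l j; first lia.
  exact: e3.
Qed.

End ExchangeOperator.
(** * Existence and uniqueness of the interpolation polynomials *)

Section Construction.
Variables (K : fieldType) (q t : K) (n : nat).
Hypothesis gen : generic q t.
Implicit Types (p : mpoly n.+1 K) (u v w m : multinom n.+1).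

Local Notation sp := (spectral q t).

(** A strengthening of [interp_spec] that the recursion preserves: the support is bounded in the
    Bruhat order, and the value at <u> is explicit, with the power of t multiplied out. *)
Definition interp_ok u p := [/\ forall m, m \in msupp p -> lew m u,
  mcoeff u p = q ^- nstat' u,
  forall w, (mdeg w <= mdeg u)%N -> w != u -> meval (sp w) p = 0
  & meval (sp u) p * t ^+ nstat u =
    (-1) ^+ mdeg u * cprime q t u * t ^+ rank_weight u].

Lemma interp_ok_msize u p : interp_ok u p -> msize p = (mdeg u).+1.
Proof.
case=> supp coef _ _; apply/eqP; rewrite eqn_leq; apply/andP; split.
  by rewrite msizeE; apply/bigmax_leqP_seq => m mp _; rewrite ltnS; apply/lew_mdeg/supp.
apply: msize_mdeg_lt; rewrite mcoeff_msupp coef invr_neq0 // expf_neq0 //.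
exact: generic_q0 gen.
Qed.

Lemma spectral_rotx u : rotx q (sp (rotc u)) =1 sp u.
Proof.
move=> i; rewrite /rotx !spectralE rank_rotc rotcE ord_predK.
have -> : (ord_pred i == ord_max) = (i == ord0).
  by rewrite -(inj_eq (@ordS_inj _)) ord_predK ordS_max.
have q0 := generic_q0 gen.
by case: eqP => _; rewrite ?addn0 ?divr1 // addn1 exprS; field.
Qed.

(** A zero last part has rank 0; the factor x_n - 1 of [phi] therefore kills every such point. *)
Lemma spectral_max u : u ord_max = 0%N -> sp u ord_max = 1.
Proof.
move=> u0; rewrite spectralE u0 spectral_expE eq_card0 ?mulr1 // => k.
by rewrite !inE /below u0 ltn0 /=; have := ltn_ord k; lia.
Qed.

Lemma meval_phi_rotc u p : meval (sp (rotc u)) (phi q p) =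
  (q * sp u ord0 - 1) * meval (sp u) p.
Proof.
rewrite meval_phi (meval_eq _ (spectral_rotx u)); congr ((_ - _) * _).
rewrite !spectralE rank_rotc rotcE eqxx addn1 ordS_max exprS; ring.
Qed.

Lemma meval_phi_max u p : u ord_max = 0%N -> meval (sp u) (phi q p) = 0.
Proof. by move=> u0; rewrite meval_phi spectral_max // subrr mul0r. Qed.

Lemma interp_ok_rotc u p : interp_ok u p -> interp_ok (rotc u) (phi q p).
Proof.
move=> ok_p; have [supp coef van val] := ok_p; split.
- by move=> m /msupp_phi[m' /supp m'u] /lew_trans; apply; exact: lew_rotc.
- rewrite (mcoeff_phi _ (interp_ok_msize ok_p)) coef nstat'_rotc exprD invfM.
  by rewrite mulrC.
- move=> w; rewrite mdeg_rotc; have [w0|w_gt0] := posnP (w ord_max).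
    by move=> _ _; exact: meval_phi_max.
  have [w' ->] := rotc_surj w_gt0; rewrite mdeg_rotc (inj_eq (@rotc_inj _)).
  by move=> w'u nw'u; rewrite meval_phi_rotc van ?mulr0.
- rewrite meval_phi_rotc mdeg_rotc nstat_rotc cprime_rotc rank_weight_rotc.
  rewrite spectralE; set r := spectral_exp u ord0.
  transitivity ((q * (q ^+ u ord0 * t ^+ r) - 1) * t ^+ r *
                (meval (sp u) p * t ^+ nstat u)); first by rewrite exprD; ring.
  by rewrite val !exprD !exprS; ring.
Qed.

Lemma interp_ok_swapc (i j : 'I_n.+1) u p :
  j = i.+1 :> nat -> u i = 0%N -> (0 < u j)%N -> interp_ok u p ->
  exists p', interp_ok (swapc i j u) p'.
Proof.
move=> ij ui0 uj_gt0 [supp coef van val].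
have nij : i != j by rewrite -val_eqE /= ij; lia.
have nuij : u i != u j by rewrite ui0; lia.
have nsu : swapc i j u != u.
  by apply/eqP => /(congr1 (fun a : multinom _ => a i)); rewrite swapcE tpermL ui0; lia.
pose X := sp u i; pose Y := sp u j.
have XY : X - Y != 0 by rewrite subr_eq0 spectral_distinct.
(* Chosen so that [c *: p + exch t i j p] vanishes at <u>. *)
pose c := (X - t * Y) / (X - Y).
have ev w : meval (sp w) (c *: p + exch t i j p) = c * meval (sp w) p +
    (sp w i - t * sp w j) / (sp w i - sp w j) *
    (meval (swapx i j (sp w)) p - meval (sp w) p).
  by rewrite mevalD mevalZ meval_exch // spectral_distinct.
have ev_ne w : w i != w j ->
    meval (swapx i j (sp w)) p = meval (sp (swapc i j w)) p.
  by move=> nw; apply: meval_eq => k; rewrite spectral_swapc.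
exists (c *: p + exch t i j p); split.
- move=> m /msuppD_le; rewrite mem_cat => /orP[/msuppZ_le/supp mu|].
    exact: lew_swapc_id.
  case/msupp_mlin => m1 /supp m1u /(msupp_exch_mnm nij).
  case => a [r [-> sum max_le]].
  apply: (lew_swapc ij ui0 uj_gt0 m1u).
  - by move=> k /negbTE ki /negbTE kj; rewrite setpE ki kj.
  - by rewrite !setpE !eqxx [j == i]eq_sym (negbTE nij).
  - by rewrite !setpE !eqxx [j == i]eq_sym (negbTE nij).
- have sup : swapc i j u \notin msupp p.
    by apply/negP => /supp; exact: lew_swapcN.
  rewrite mcoeffD mcoeffZ (memN_msupp_eq0 sup) mulr0 add0r mcoeff_exch //.
  by rewrite nstat'_swapc.
- move=> w; rewrite mdeg_swapc => wu nwsu; rewrite ev.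
  have [wij|nwij] := eqVneq (w i) (w j).
    rewrite (spectral_adjacent q t ij wij) subrr !mul0r addr0 van ?mulr0 //.
    by apply: contraNneq nuij => <-; rewrite wij.
  rewrite ev_ne //; have [->|nwu] := eqVneq w u.
    by rewrite (van (swapc i j u)) ?mdeg_swapc // -/X -/Y /c; ring.
  rewrite (van w) // (van (swapc i j w)) ?mdeg_swapc //; first by ring.
  by apply: contraNneq nwsu => <-; rewrite swapcK.
have nsuij : swapc i j u i != swapc i j u j.
  by rewrite !swapcE tpermL tpermR eq_sym.
rewrite ev ev_ne // swapcK (van (swapc i j u)) ?mdeg_swapc //.
rewrite !spectral_swapc // tpermL tpermR -/X -/Y rank_weight_swapc //.
have ec := cprime_swapc ij ui0 uj_gt0 q t.
move: val; rewrite -(nstat_swapc ij ui0 uj_gt0) exprS => val.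
have eY := rank_leg ij ui0 uj_gt0.
rewrite -(leg_swapc_first ij ui0 uj_gt0) /= in ec eY.
set B := q ^+ u j * t ^+ leg (swapc i j u) i 1 in ec.
have eB : q ^+ u j * t ^+ (leg (swapc i j u) i 1).+1 = t * B.
  by rewrite exprS /B; ring.
have D : 1 - t * B != 0 by rewrite -eB (generic_neq1 gen).
rewrite eB in ec.
have eYX : Y = X * (t * B).
  by rewrite -eB /X /Y !spectralE ui0 eY exprD; ring.
(* The value at the swapped point is p(<u>) times (Y - t X) / (Y - X); with Y = t B X this is the
   ratio of the two [cprime] up to the lost power of t. *)
have ratio : (Y - t * X) / (Y - X) * (1 - t * B) = t * (1 - B).
  have D' : t * B - 1 != 0 by rewrite -oppr_eq0 opprB.
  have X0 : X != 0 by exact: spectral_neq0.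
  rewrite eYX; field.
  by rewrite -[X in _ - X]mulr1 -mulrBr mulf_neq0.
apply: (mulIf D).
transitivity (t * (1 - B) * meval (sp u) p * t ^+ nstat (swapc i j u)).
  by rewrite -ratio; ring.
transitivity ((-1) ^+ mdeg u * ((1 - t * B) * cprime q t (swapc i j u))
              * t ^+ rank_weight u); last by ring.
rewrite ec.
transitivity ((1 - B) * (meval (sp u) p * (t * t ^+ nstat (swapc i j u)))).
  by ring.
by rewrite val; ring.
Qed.

Lemma interp_ok0 : interp_ok (mnm0 : multinom n.+1) 1.
Proof.
have s0 (F : 'I_n.+1 -> nat -> nat) :
    (\sum_(i < n.+1) \sum_(1 <= c < ((mnm0 : multinom n.+1) i).+1) F i c = 0)%N.
  by rewrite big1 // => i _; rewrite mnm0E big_geq.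
split.
- by move=> m; rewrite -mpolyC1 msupp1 inE => /eqP ->.
- rewrite mcoeff1 eqxx /nstat' big1 ?expr0 ?invr1 // => i _.
  by rewrite mnm0E bin0n.
- by move=> w; rewrite mdeg0 leqn0 mdeg_eq0 => ->.
- rewrite meval1 /nstat s0 mdeg0 /cprime big1 => [|i _]; last first.
    by rewrite mnm0E big_geq.
  rewrite /rank_weight big1 ?expr0 ?mulr1 // => i _.
  by rewrite mnm0E muln0.
Qed.

Lemma interp_ok_ex u : exists p, interp_ok u p.
Proof.
have [d] := ubnP (mdeg u); elim: d u => // d IHd u; rewrite ltnS => ud.
have [->|nu] := eqVneq u mnm0; first by exists 1; exact: interp_ok0.
(* Induction on the number s of trailing zeros of u. *)
suff tail s : forall v (k : 'I_n.+1), (mdeg v <= d)%N -> (k + s = n)%N ->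
    (0 < v k)%N -> (forall l : 'I_n.+1, (k < l)%N -> v l = 0%N) ->
    exists p, interp_ok v p.
  have [k0 k0P] : exists k, (0 < u k)%N.
    apply: contrapT => /forallNP u0; case/eqP: nu; apply/mnmP => k.
    by rewrite mnm0E; have := u0 k; lia.
  case: (@arg_maxnP _ k0 (fun k => 0 < u k)%N (@nat_of_ord _) k0P) => k kP kmax.
  apply: (tail (n - k)%N u k) => //; first by have := ltn_ord k; lia.
  by move=> l kl; have := kmax l; lia.
elim: s => [|s IHs] v k vd ks vk vl.
  have ek : k = ord_max by apply/val_inj => /=; lia.
  rewrite ek in vk; have [v' ev] := rotc_surj vk.
  have [|p' ok_p'] := IHd v'; first by move: vd; rewrite ev mdeg_rotc.
  by exists (phi q p'); rewrite ev; exact: interp_ok_rotc.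
have kS : (k.+1 < n.+1)%N by lia.
(* The last nonzero part moves one place to the right; [interp_ok_swapc] moves it back. *)
pose l := Ordinal kS; pose v' := swapc k l v.
have [||||p' ok_p'] := IHs v' l.
- by rewrite mdeg_swapc.
- by rewrite /= addSn -addnS.
- by rewrite swapcE tpermR.
- move=> h lh; rewrite swapcE tpermD ?vl //; first exact: ltnW.
  + by rewrite -val_eqE /=; apply/eqP; move: lh => /=; lia.
  + by rewrite -val_eqE /=; apply/eqP; move: lh => /=; lia.
have v'k : v' k = 0%N by rewrite swapcE tpermL vl /=.
have v'l : (0 < v' l)%N by rewrite swapcE tpermR.
have := interp_ok_swapc (erefl : l = k.+1 :> nat) v'k v'l ok_p'.
by rewrite /v' swapcK.
Qed.

Definition interp_poly u : mpoly n.+1 K := sval (cid (interp_ok_ex u)).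

Lemma interp_polyP u : interp_ok u (interp_poly u).
Proof. exact: svalP (cid (interp_ok_ex u)). Qed.

Lemma interp_poly_coef u : mcoeff u (interp_poly u) != 0.
Proof.
have [_ -> _ _] := interp_polyP u.
by rewrite invr_neq0 // expf_neq0 // (generic_q0 gen).
Qed.

Lemma interp_poly_diag u : meval (sp u) (interp_poly u) != 0.
Proof.
have [_ _ _ e] := interp_polyP u.
have : meval (sp u) (interp_poly u) * t ^+ nstat u != 0.
  rewrite e !mulf_neq0 ?signr_eq0 ?cprime_neq0 ?expf_neq0 //.
  exact: generic_t0 gen.
by rewrite mulf_eq0 negb_or => /andP[].
Qed.

(* The expansion of the interpolation polynomials in monomials is triangular
   with respect to lew. *)
Lemma mpolyX_span d u : (mdeg u <= d)%N -> exists c : multinom n.+1 -> K,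
  mpolyX K u = \sum_(v : bmultinom n.+1 d.+1) c v *: interp_poly v.
Proof.
have [r] := ubnP (wt_total d.+1 u); elim: r u => // r IHr u.
rewrite ltnS => wu ud; have ud' : (mdeg u < d.+1)%N by [].
have [supp _ _ _] := interp_polyP u.
pose S (p : mpoly n.+1 K) := exists c : multinom n.+1 -> K,
  p = \sum_(v : bmultinom n.+1 d.+1) c v *: interp_poly v.
have SD p1 p2 : S p1 -> S p2 -> S (p1 + p2).
  move=> [c1 ->] [c2 ->]; exists (fun v => c1 v + c2 v).
  by rewrite -big_split; apply: eq_bigr => v _; rewrite scalerDl.
have SZ a p : S p -> S (a *: p).
  move=> [c ->]; exists (fun v => a * c v).
  by rewrite scaler_sumr; apply: eq_bigr => v _; rewrite scalerA.
have SB : S (interp_poly u).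
  exists (fun v => (v == u)%:R); rewrite (bigD1 (BMultinom ud')) //= eqxx scale1r.
  by rewrite big1 ?addr0 // => v; rewrite bmeqP => /negbTE ->; rewrite scale0r.
have S0 : S 0 by rewrite -(scale0r (interp_poly u)); exact: SZ.
have -> : mpolyX K u = (mcoeff u (interp_poly u))^-1 *: (interp_poly u +
    (-1) *: \sum_(m <- msupp (interp_poly u) | m != u)
       mcoeff m (interp_poly u) *: mpolyX K m).
  rewrite [X in X + _]mpolyE (bigD1_seq u) ?msupp_uniq ?mcoeff_msupp //=;
    last exact: interp_poly_coef.
  rewrite scaleN1r addrK scalerA mulVf ?scale1r //.
  exact: interp_poly_coef.
apply: (SZ); apply: (SD) => //; apply: (SZ); rewrite big_seq_cond.
apply: big_ind => // m /andP[mp nmu]; apply: SZ.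
have md : (mdeg m <= d)%N by apply: leq_trans (lew_mdeg (supp m mp)) ud.
by apply: IHr => //; apply: leq_trans wu; apply: lew_lt_total (supp m mp) nmu.
Qed.

Lemma interp_span d p : (msize p <= d.+1)%N -> exists c : multinom n.+1 -> K,
  p = \sum_(v : bmultinom n.+1 d.+1) c v *: interp_poly v.
Proof.
move=> szp; have /choice[c cP] : forall m : multinom n.+1,
    exists c : multinom n.+1 -> K, (mdeg m <= d)%N ->
    mpolyX K m = \sum_(v : bmultinom n.+1 d.+1) c v *: interp_poly v.
  move=> m; have [md|_] := leqP (mdeg m) d; last by exists (fun=> 0).
  by have [c cP] := mpolyX_span md; exists c.
exists (fun v => \sum_(m : bmultinom n.+1 d.+1) mcoeff m p * c m v).
rewrite {1}(mpolywE szp) (eq_bigr (fun m : bmultinom n.+1 d.+1 =>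
  \sum_(v : bmultinom n.+1 d.+1) (mcoeff m p * c m v) *: interp_poly v)).
  by rewrite exchange_big; apply: eq_bigr => v _; rewrite scaler_suml.
move=> m _; rewrite (cP m (bmdeg m)) scaler_sumr.
by apply: eq_bigr => v _; rewrite scalerA.
Qed.

(** By induction on the degree of w: at <w>, the terms of lower degree have zero coefficient
    already, and of the rest only M_w survives. *)
Lemma interp_comb_eq0 d (c : multinom n.+1 -> K) :
  (forall w, (mdeg w < d)%N ->
   meval (sp w) (\sum_(v : bmultinom n.+1 d) c v *: interp_poly v) = 0) ->
  forall w, (mdeg w < d)%N -> c w = 0.
Proof.
move=> van w; have [e] := ubnP (mdeg w); elim: e w => // e IHe w.
rewrite ltnS => we wd; apply: (mulIf (interp_poly_diag w)); rewrite mul0r.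
rewrite -[RHS](van w wd) raddf_sum (bigD1 (BMultinom wd)) //= mevalZ.
rewrite big1 ?addr0 // => v; rewrite bmeqP /= => nvw; rewrite mevalZ.
have [wv|vw] := leqP (mdeg w) (mdeg v).
  by have [_ _ vanv _] := interp_polyP v; rewrite vanv ?mulr0 // eq_sym.
by rewrite IHe ?mul0r ?bmdeg //; exact: leq_trans vw we.
Qed.

(** The bound [d] on [msize] means degree less than d, matching the degrees of the test points. *)
Lemma interp_unique d p : (msize p <= d)%N ->
  (forall w, (mdeg w < d)%N -> meval (sp w) p = 0) -> p = 0.
Proof.
case: d => [|d].
  by rewrite leqn0 msize_poly_eq0 => /eqP.
move=> /interp_span[c ->] /interp_comb_eq0 c0.
by rewrite big1 // => v _; rewrite c0 ?scale0r ?bmdeg.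
Qed.

Lemma meval_inj p : (forall w, meval (sp w) p = 0) -> p = 0.
Proof. by move=> p0; apply: (@interp_unique (msize p)). Qed.

(** The vanishing conditions determine the polynomial up to a factor, and the coefficient of x^u
    fixes that factor. *)
Lemma interpME u : interpM q t u = interp_poly u.
Proof.
have ok := interp_polyP u; have [supp coef van _] := ok.
have spec : interp_spec q t u (interp_poly u).
  by split => //; exact: interp_ok_msize.
rewrite /interpM; case: xgetP => [p _ [szp vanp coefp]|none]; last first.
  by case: (none (interp_poly u)).
apply/eqP; rewrite -subr_eq0; apply/eqP.
pose a := meval (sp u) p / meval (sp u) (interp_poly u).
have e : p - a *: interp_poly u = 0.
  apply: (@interp_unique (mdeg u).+1).
    apply: leq_trans (msizeD_le _ _) _; rewrite geq_max szp leqnn /=.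
    by rewrite msizeN (leq_trans (msizeZ_le _ _)) // (interp_ok_msize ok).
  move=> w; rewrite ltnS => wu; rewrite mevalB mevalZ.
  have [->|nwu] := eqVneq w u; first by rewrite divfK ?subrr ?interp_poly_diag.
  by rewrite vanp // van // mulr0 subrr.
have a1 : a = 1.
  have := congr1 (mcoeff u) e; rewrite mcoeffB mcoeffZ mcoeff0 coefp coef.
  move/eqP; rewrite subr_eq0 => /eqP eqa.
  apply: (@mulIf _ (q ^- nstat' u)); last by rewrite mul1r -eqa.
  by rewrite -coef interp_poly_coef.
by rewrite -[RHS]e a1 scale1r.
Qed.

End Construction.
(** * Extra vanishing *)

Section HeckeOperator.
Variables (K : fieldType) (q t : K) (n : nat).
Hypothesis gen : generic q t.
Implicit Types (f g p : mpoly n.+1 K) (u v w m : multinom n.+1).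
Implicit Types (x : 'I_n.+1 -> K).

Local Notation sp := (spectral q t).

(** The Demazure-Lusztig operator T_k. *)
Definition hecke (k : nat) f : mpoly n.+1 K :=
  t *: f + exch t (inord k) (inord k.+1) f.

Definition adj (k : nat) : {perm 'I_n.+1} := tperm (inord k) (inord k.+1).

Lemma adj_ordP k : (k < n)%N ->
  (inord k.+1 : 'I_n.+1) = (inord k : 'I_n.+1).+1 :> nat.
Proof. by move=> kn; rewrite !inordK // ltnW. Qed.

Lemma adj_neq k : (k < n)%N -> (inord k : 'I_n.+1) != inord k.+1.
Proof. by move=> kn; rewrite -val_eqE /= adj_ordP //; lia. Qed.

Lemma meval_hecke x k f : (k < n)%N -> x (inord k) != x (inord k.+1) ->
  meval x (hecke k f) = t * meval x f +
    (x (inord k) - t * x (inord k.+1)) / (x (inord k) - x (inord k.+1)) *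
    (meval (x \o adj k) f - meval x f).
Proof.
by move=> kn nx; rewrite mevalD mevalZ meval_exch //; exact: adj_neq.
Qed.

Lemma msize_hecke k f : (k < n)%N -> (msize (hecke k f) <= msize f)%N.
Proof.
move=> kn; apply: leq_trans (msizeD_le _ _) _; rewrite geq_max msizeZ_le /=.
rewrite [X in (X <= _)%N]msizeE; apply/bigmax_leqP_seq => a + _.
case/msupp_mlin => m mf /(msupp_exch_mnm (adj_neq kn))[b [r [-> sum _]]].
suff -> : mdeg (setp (inord k) (inord k.+1) m b r) = mdeg m.
  exact: msize_mdeg_lt.
have nkk := adj_neq kn.
rewrite !mdegE (bigD1 (inord k)) //= (bigD1 (inord k.+1)) 1?eq_sym //=.
rewrite [RHS](bigD1 (inord k)) //= [in RHS](bigD1 (inord k.+1)) 1?eq_sym //=.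
rewrite !addnA !setpE !eqxx [inord k.+1 == _]eq_sym (negbTE nkk) sum.
congr (_ + _)%N; apply: eq_bigr => l /andP[/negbTE lk /negbTE lk1].
by rewrite setpE lk lk1.
Qed.

Definition vanish_on (Z : multinom n.+1 -> Prop) f :=
  forall w, Z w -> meval (sp w) f = 0.

Definition swap_closed (Z : multinom n.+1 -> Prop) :=
  forall i j : 'I_n.+1, forall w, Z w -> Z (swapc i j w).

(** At <w> the operator involves only f(<w>) and f at the swapped point; when the two parts are
    equal, the latter is not spectral but its coefficient is zero. *)
Lemma vanish_hecke Z k f : (k < n)%N -> swap_closed Z ->
  vanish_on Z f -> vanish_on Z (hecke k f).
Proof.
move=> kn swZ fZ w Zw; have nk := adj_neq kn.
rewrite meval_hecke ?(spectral_distinct gen) // fZ // mulr0 add0r subr0.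
have [wk|nwk] := eqVneq (w (inord k)) (w (inord k.+1)).
  by rewrite (spectral_adjacent q t (adj_ordP kn) wk) subrr !mul0r.
rewrite (@meval_eq _ _ _ (sp (swapc (inord k) (inord k.+1) w))) => [|l].
  by rewrite fZ ?mulr0 //; exact: swZ.
by rewrite spectral_swapc // adj_ordP.
Qed.

Lemma vanish_phi (Z Z' : multinom n.+1 -> Prop) f :
  (forall w, Z' (rotc w) -> Z w) -> vanish_on Z f -> vanish_on Z' (phi q f).
Proof.
move=> ZZ' fZ w; have [w0 _|w_gt0] := posnP (w ord_max).
  exact: meval_phi_max.
have [w' ->] := rotc_surj w_gt0; move/ZZ'/fZ => fw'.
by rewrite meval_phi_rotc // fw' mulr0.
Qed.

Lemma msize_phi f : (msize (phi q f) <= (msize f).+1)%N.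
Proof.
rewrite [X in (X <= _)%N]msizeE; apply/bigmax_leqP_seq => a + _.
case/msupp_phi => m mf /lew_mdeg; rewrite mdeg_rotc ltnS => am.
exact: leq_trans am (msize_mdeg_lt mf).
Qed.

(* T_(n-s) ... T_(n-1) and T_0 ... T_(i-1) *)
Fixpoint heckeL s f := if s is s'.+1 then hecke (n - s) (heckeL s' f) else f.
Fixpoint heckeR i f := if i is i'.+1 then heckeR i' (hecke i' f) else f.

Lemma heckeL_ind (P : mpoly n.+1 K -> Prop) s f : (s <= n)%N ->
  (forall k g, (k < n)%N -> P g -> P (hecke k g)) -> P f -> P (heckeL s f).
Proof.
move=> + hP Pf; elim: s => //= s IHs sn.
by apply: hP; [lia | apply: IHs; exact: ltnW].
Qed.

Lemma heckeR_ind (P : mpoly n.+1 K -> Prop) i f : (i <= n)%N ->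
  (forall k g, (k < n)%N -> P g -> P (hecke k g)) -> P f -> P (heckeR i f).
Proof.
move=> + hP; elim: i f => //= i IHi f lt_in Pf.
by apply: IHi; [exact: ltnW | exact: hP].
Qed.

(** The index permutations that [heckeL] and [heckeR] reduce to at a point with a single zero
    coordinate. *)
Fixpoint cycL s (k : 'I_n.+1) := if s is s'.+1 then adj (n - s) (cycL s' k) else k.
Fixpoint cycR i (k : 'I_n.+1) := if i is i'.+1 then cycR i' (adj i' k) else k.

Lemma cycL_val s k : (s <= n)%N -> cycL s k =
  (if k < n - s then nat_of_ord k else if k == n :> nat then n - s else k.+1)%N :> nat.
Proof.
elim: s => [_|s IHs sn] /=.
  by have := ltn_ord k; rewrite subn0; repeat case: ifP; lia.
have kn : (n - s.+1 < n)%N by lia.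
have e1 : (inord (n - s.+1) : 'I_n.+1) = (n - s.+1)%N :> nat by rewrite inordK; lia.
have e2 := adj_ordP kn; rewrite e1 in e2.
rewrite tperm_val ?e1 // !(fun_if (@nat_of_ord _)) e1 e2 IHs; last exact: ltnW.
have -> : (n - s = (n - s.+1).+1)%N by lia.
by have := ltn_ord k; repeat case: ifP; lia.
Qed.

Lemma cycLR s i k : (s + i = n)%N -> cycL s (ord_pred (cycR i k)) = k.
Proof.
elim: i s k => [|i IHi] s k; rewrite ?addn0 ?addnS => si /=.
  rewrite si; have -> : cycL n (ord_pred k) = ordS (ord_pred k).
    apply/val_inj; rewrite /= -[RHS]/(ordS (ord_pred k) : nat).
    rewrite cycL_val // ordS_val subnn ltn0 -val_eqE /=.
    by case: ifP.
  by rewrite ord_predK.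
have := IHi s.+1 (adj i k); rewrite addSn => /(_ si) /=.
have -> : (n - s.+1 = i)%N by lia.
by move/(can_inj (tpermK _ _)).
Qed.

Definition zero_at x (k : 'I_n.+1) := forall l, (x l == 0) = (l == k).

Lemma zero_at_adj x k : zero_at x (inord k) -> zero_at (x \o adj k) (inord k.+1).
Proof.
move=> xk l; rewrite xk -[in RHS](inj_eq (@perm_inj _ (adj k))).
by rewrite /adj tpermR.
Qed.

(** For x_k = 0 the fraction in T_k equals t, so T_k acts as t s_k. *)
Lemma meval_hecke_zero x k f : (k < n)%N -> zero_at x (inord k) ->
  meval x (hecke k f) = t * meval (x \o adj k) f.
Proof.
move=> kn xk; have xk0 : x (inord k) = 0 by apply/eqP; rewrite xk.
have xk1 : x (inord k.+1) != 0 by rewrite xk eq_sym adj_neq.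
by rewrite meval_hecke // xk0 1?eq_sym //; field; rewrite oppr_eq0.
Qed.

Lemma meval_heckeL x s f : (s <= n)%N -> zero_at x (inord (n - s)) ->
  meval x (heckeL s f) = t ^+ s * meval (x \o cycL s) f
  /\ zero_at (x \o cycL s) ord_max.
Proof.
elim: s x => [|s IHs] x /= sn xs.
  rewrite mul1r; split => //; move: xs; rewrite subn0.
  by have -> : inord n = ord_max :> 'I_n.+1 by apply/val_inj; rewrite /= inordK.
have kn : (n - s.+1 < n)%N by lia.
have := zero_at_adj xs; have -> : (n - s.+1).+1 = (n - s)%N by lia.
move=> /(IHs _ (ltnW sn))[e z]; split; last exact: z.
by rewrite meval_hecke_zero // e exprS mulrA.
Qed.

Lemma meval_heckeR x i f : (i <= n)%N -> zero_at x ord0 ->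
  meval x (heckeR i f) = t ^+ i * meval (x \o cycR i) f
  /\ zero_at (x \o cycR i) (inord i).
Proof.
move=> + x0; elim: i f => [|i IHi] f /= lt_in.
  rewrite mul1r; split => //; suff -> : inord 0 = ord0 :> 'I_n.+1 by [].
  by apply/val_inj; rewrite /= inordK.
have [e z] := IHi (hecke i f) (ltnW lt_in).
by rewrite e meval_hecke_zero // mulrA -exprSr; split => //; exact: (zero_at_adj z).
Qed.

Definition cherednik (i : 'I_n.+1) f := heckeL (n - i) (phi q (heckeR i f)).

(** Each Hecke factor acts as t times a transposition and [phi] contributes 0 - 1; by [cycLR] the
    permutations and the rotation cancel. Hence t^n f + [cherednik i f] is divisible by x_i. *)
Lemma meval_cherednik_zero x i f : zero_at x i ->
  meval x (cherednik i f) = - t ^+ n * meval x f.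
Proof.
move=> xi; have le_in : (i <= n)%N by rewrite -ltnS ltn_ord.
have xi' : zero_at x (inord (n - (n - i))) by rewrite subKn // inord_val.
have [-> z] := meval_heckeL (phi q (heckeR i f)) (leq_subr i n) xi'.
rewrite meval_phi; set y := x \o cycL (n - i) in z *.
have y0 : y ord_max = 0 by apply/eqP; rewrite z.
have rE : rotx q y =1 y \o @ord_pred n.+1.
  move=> k; rewrite /rotx /=; case: eqP => [->|_]; last by rewrite divr1.
  suff -> : ord_pred ord0 = ord_max :> 'I_n.+1 by rewrite y0 mul0r.
  by rewrite -ordS_max ordSK.
have z0 : zero_at (y \o @ord_pred n.+1) ord0.
  by move=> l; rewrite z -ordS_max -[in RHS](ord_predK l) (inj_eq (@ordS_inj _)).
rewrite (meval_eq _ rE); have [-> _] := meval_heckeR f le_in z0.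
rewrite (@meval_eq _ _ _ x) => [|k]; last by rewrite /= /y /= cycLR ?subnK.
have -> : t ^+ n = t ^+ (n - i) * t ^+ i by rewrite -exprD subnK.
by rewrite y0; ring.
Qed.

Lemma msize_cherednik i f : (msize (cherednik i f) <= (msize f).+1)%N.
Proof.
have le_in : (i <= n)%N by rewrite -ltnS ltn_ord.
apply: (@heckeL_ind (fun g => msize g <= (msize f).+1)%N); first exact: leq_subr.
  by move=> k g kn; exact: leq_trans (msize_hecke g kn).
apply: leq_trans (msize_phi _) _; rewrite ltnS.
apply: (@heckeR_ind (fun g => msize g <= msize f)%N) => // k g kn.
exact: leq_trans (msize_hecke g kn).
Qed.

Lemma vanish_cherednik (Z Z' : multinom n.+1 -> Prop) i f :
  swap_closed Z -> swap_closed Z' -> (forall w, Z' (rotc w) -> Z w) ->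
  vanish_on Z f -> vanish_on Z' (cherednik i f).
Proof.
have le_in : (i <= n)%N by rewrite -ltnS ltn_ord.
move=> sZ sZ' ZZ' fZ; apply: (@heckeL_ind (vanish_on Z')); first exact: leq_subr.
  by move=> k g kn; exact: vanish_hecke.
apply: (vanish_phi ZZ'); apply: (@heckeR_ind (vanish_on Z)) => // k g kn.
exact: vanish_hecke.
Qed.

Lemma mpoly_factor_var i p : (forall x, zero_at x i -> meval x p = 0) ->
  exists2 g, p = mpolyX K (mnm1 i) * g & (msize g <= (msize p).-1)%N.
Proof.
move=> p0.
pose p1 := \sum_(m <- msupp p | (m i == 0)%N) mcoeff m p *: mpolyX K m.
pose g := \sum_(m <- msupp p | (m i != 0)%N)
  mcoeff m p *: mpolyX K (mnm_sub m (mnm1 i)).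
have pE : p = p1 + mpolyX K (mnm1 i) * g.
  rewrite {1}[p]mpolyE (bigID (fun m : multinom _ => m i == 0%N)) /=; congr (_ + _).
  rewrite mulr_sumr; apply: eq_bigr => m mi.
  by rewrite -scalerAr -mpolyXD addmC submK // lep1mP.
have p10 : p1 = 0.
  apply: (meval_inj gen) => w.
  (* [p1] collects the monomials free of x_i, so replacing that coordinate of <w> by 0 does not
     change its value. *)
  pose x k := if k == i then 0 else sp w k.
  have xi : zero_at x i.
    move=> l; rewrite /x; case: (eqVneq l i) => _; first by rewrite eqxx.
    exact: negbTE (spectral_neq0 gen _ _).
  have xi0 : x i = 0 by rewrite /x eqxx.
  have := p0 _ xi; rewrite pE mevalD mevalM mevalXU xi0 mul0r addr0 => <-.
  rewrite !raddf_sum; apply: eq_bigr => m /eqP mi; rewrite /= !mevalZ !mevalX.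
  congr (_ * _); apply: eq_bigr => k _; rewrite /x.
  by case: eqP => // ->; rewrite mi !expr0.
exists g; first by rewrite {1}pE p10 add0r.
apply: leq_trans (msize_sum _ _ _) _; apply/bigmax_leqP_seq => m mp mi.
apply: leq_trans (msizeZ_le _ _) _; rewrite msizeX.
have := msize_mdeg_lt mp; have <- : mdeg (mnm_add (mnm_sub m (mnm1 i)) (mnm1 i)) = mdeg m.
  by rewrite submK // lep1mP.
by rewrite mdegD mdeg1; lia.
Qed.

Local Notation M := (interp_poly gen).

(* Eigenvalue equation for the Cherednik operator
   x_i^-1 (1 + t^-n T_i ... T_(n-1) Phi T_0 ... T_(i-1)). *)
Lemma cherednik_interp i v : t ^+ n *: M v + cherednik i (M v) =
  mpolyX K (mnm1 i) * ((t ^+ n / sp v i) *: M v).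
Proof.
have [supp _ van _] := interp_polyP gen v.
have szM := interp_ok_msize gen (interp_polyP gen v).
have [x xi|g gE szg] := @mpoly_factor_var i (t ^+ n *: M v + cherednik i (M v)).
  by rewrite mevalD mevalZ meval_cherednik_zero // mulNr addrN.
rewrite gE; congr (_ * _); apply/eqP; rewrite -subr_eq0; apply/eqP.
(* Both sides have degree at most |v|, so the points <w> with |w| <= |v| decide; there the
   [cherednik] term vanishes, since M_v vanishes in degrees below |v|. *)
apply: (interp_unique gen (d := (mdeg v).+1)) => [|w].
  apply: leq_trans (msizeD_le _ _) _; rewrite geq_max msizeN; apply/andP; split.
    apply: leq_trans szg _; rewrite -subn1 leq_subLR add1n -szM.
    apply: leq_trans (msizeD_le _ _) _; rewrite geq_max msize_cherednik andbT.
    exact: leq_trans (msizeZ_le _ _) (leqnSn _).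
  by rewrite -szM msizeZ_le.
rewrite ltnS => wv; apply: (mulfI (spectral_neq0 gen w i)); rewrite mulr0.
have := congr1 (meval (sp w)) gE; rewrite mevalM mevalD mevalXU mevalZ.
rewrite mevalB mulrBr => <-; rewrite mevalZ.
rewrite (@vanish_cherednik (fun w => mdeg w < mdeg v)%N (fun w => mdeg w <= mdeg v)%N);
  last exact: wv.
- rewrite addr0; have [->|nwv] := eqVneq w v.
    by field; rewrite spectral_neq0.
  by rewrite van // !mulr0 subrr.
- by move=> a b y; rewrite mdeg_swapc.
- by move=> a b y; rewrite mdeg_swapc.
- by move=> y; rewrite mdeg_rotc.
- by move=> y yv; apply: van; [exact: ltnW | apply: contraTneq yv => ->; rewrite ltnn].
Qed.

(** Induction on |w|. If v^+ is not contained in w^+, the [cherednik] term at <w> involves M_v only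
    at smaller compositions whose parts fit in w^+, where it vanishes by induction. The eigenvalue
    equation, for an i with <w>_i != <v>_i, then gives M_v(<w>) = 0. *)
Lemma extra_vanishing v w : meval (sp w) (M v) != 0 ->
  forall c, (nparts v c <= nparts w c)%N.
Proof.
have [d] := ubnP (mdeg w); elim: d w => // d IHd w; rewrite ltnS => wd Mw c.
rewrite leqNgt; apply: contra Mw => lt_c; apply/eqP.
have nwv : w <> v by move=> wv; move: lt_c; rewrite wv ltnn.
have [i nwvi] : exists i, sp w i != sp v i.
  apply: contrapT => /forallNP eq_wv; apply: nwv; apply: (spectral_eq gen) => i.
  by apply/eqP/negPn/negP/eq_wv.
have := congr1 (meval (sp w)) (cherednik_interp i v).
rewrite mevalM mevalD mevalXU !mevalZ.
rewrite (@vanish_cherednik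
  (fun y => mdeg y < mdeg w /\ forall c, nparts y c <= nparts w c)%N
  (fun y => mdeg y <= mdeg w /\ forall c, nparts y c <= nparts w c)%N) //.
- move=> e; apply: contraNeq nwvi => Mw.
  have tn : t ^+ n != 0 by rewrite expf_neq0 // (generic_t0 gen).
  have vi := spectral_neq0 gen v i.
  apply/eqP/esym; apply: (mulIf (mulf_neq0 tn Mw)).
  have := congr1 (fun z => sp v i * z) e; rewrite addr0 /= => ->.
  by field.
- by move=> a b y [yd yw]; rewrite mdeg_swapc; split => // l; rewrite nparts_swapc.
- by move=> a b y [yd yw]; rewrite mdeg_swapc; split => // l; rewrite nparts_swapc.
- move=> y [yd yw]; rewrite mdeg_rotc in yd; split => // l.
  exact: leq_trans (nparts_rotc y l) (yw l).
- move=> y [yd yw]; apply/eqP; apply: contraTT lt_c => My; rewrite -leqNgt.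
  by apply: leq_trans (yw c); apply: IHd My c; apply: leq_trans yd wd.
Qed.

End HeckeOperator.
(** * The q-binomial theorem for interpolation polynomials *)

Section FpsMorphisms.
Variable K : fieldType.
Implicit Types (f g : fps K) (p : {poly K}) (y z : K).

Lemma coefpsD f g k : coefps (f + g) k = coefps f k + coefps g k.
Proof. by []. Qed.

Lemma coefpsM f g k :
  coefps (f * g) k = \sum_(i < k.+1) coefps f i * coefps g (k - i).
Proof. by []. Qed.

Lemma coefps0 k : coefps (0 : fps K) k = 0.
Proof. by rewrite /= mul0rn. Qed.

Lemma coefps_sum (I : Type) (r : seq I) (P : pred I) (G : I -> fps K) k :
  coefps (\sum_(i <- r | P i) G i) k = \sum_(i <- r | P i) coefps (G i) k.
Proof.
by apply: (big_morph (fun f => coefps f k)) => [f g|]; rewrite ?coefpsD ?coefps0.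
Qed.

Lemma coefpsCM y f k : coefps (y%:S * f) k = y * coefps f k.
Proof.
rewrite coefpsM big_ord_recl /= mulr1n subn0 big1 ?addr0 // => i _.
by rewrite mul0r.
Qed.

Lemma fps_unitE f : (f \is a GRing.unit) = (coefps f 0 != 0).
Proof. by []. Qed.

(** The substitution of y z for z. *)
Definition fps_scale y f : fps K := Fps (fun k => y ^+ k * coefps f k).

Lemma coefps_scale y f k : coefps (fps_scale y f) k = y ^+ k * coefps f k.
Proof. by []. Qed.

Lemma fps_scale_additive y : additive (fps_scale y).
Proof. by move=> f g; apply: fpsP => k /=; rewrite mulrDr mulrN. Qed.

Lemma fps_scale_multiplicative y : multiplicative (fps_scale y).
Proof.
split=> [f g|]; apply: fpsP => k; rewrite ?coefpsM /=; last first.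
  by case: k => [|k]; rewrite ?mulr0 ?mul1r.
rewrite mulr_sumr; apply: eq_bigr => i _.
rewrite -{1}(@subnKC i k) -1?ltnS // exprD; ring.
Qed.

HB.instance Definition _ y :=
  GRing.isAdditive.Build (fps K) (fps K) (fps_scale y) (fps_scale_additive y).
HB.instance Definition _ y :=
  GRing.isMultiplicative.Build (fps K) (fps K) (fps_scale y)
    (fps_scale_multiplicative y).

Lemma fps_scale_scale y z f : fps_scale y (fps_scale z f) = fps_scale (y * z) f.
Proof. by apply: fpsP => k /=; rewrite exprMn mulrA. Qed.

Lemma fps_scale_unit y f :
  (fps_scale y f \is a GRing.unit) = (f \is a GRing.unit).
Proof. by rewrite !fps_unitE /= mul1r. Qed.

Definition fps_poly p : fps K := Fps (fun k => p`_k).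

Lemma fps_poly_additive : additive fps_poly.
Proof. by move=> p r; apply: fpsP => k /=; rewrite coefB. Qed.

Lemma fps_poly_multiplicative : multiplicative fps_poly.
Proof.
split=> [p r|]; apply: fpsP => k; rewrite ?coefpsM /= ?coefM ?coef1 //.
Qed.

HB.instance Definition _ :=
  GRing.isAdditive.Build {poly K} (fps K) fps_poly fps_poly_additive.
HB.instance Definition _ :=
  GRing.isMultiplicative.Build {poly K} (fps K) fps_poly fps_poly_multiplicative.

End FpsMorphisms.

(** * Power series with polynomial coefficients of bounded degree *)

Section PolynomialFamily.
Variables (K : fieldType) (n : nat).
Implicit Types (G H : ('I_n -> K) -> fps K) (p r : mpoly n K).

Lemma msizeM_pred p r : (msize (p * r) <= (msize p + msize r).-1)%N.
Proof.
have [->|p0] := eqVneq p 0; first by rewrite mul0r msize0.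
have [->|r0] := eqVneq r 0; first by rewrite mulr0 msize0.
by rewrite msizeM.
Qed.

Lemma msize_sum_le (I : finType) (P : pred I) (F : I -> mpoly n K) d :
  (forall i, P i -> msize (F i) <= d)%N -> (msize (\sum_(i | P i) F i) <= d)%N.
Proof. by move=> Fd; apply: leq_trans (msize_sum _ _ _) _; apply/bigmax_leqP. Qed.

Definition polyfam G := exists h : nat -> mpoly n K,
  forall k, (msize (h k) <= k.+1)%N /\ forall x, coefps (G x) k = meval x (h k).

Lemma polyfam1 : polyfam (fun=> 1).
Proof.
exists (fun k => if k == 0%N then 1 else 0) => -[|k] /=.
  by rewrite msize1; split=> // x; rewrite meval1.
by rewrite msize0; split=> // x; rewrite meval0.
Qed.

Lemma polyfamM G H : polyfam G -> polyfam H -> polyfam (fun x => G x * H x).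
Proof.
move=> [g gP] [h hP]; exists (fun k => \sum_(i < k.+1) g i * h (k - i)%N) => k.
split=> [|x].
  apply: msize_sum_le => i _; apply: leq_trans (msizeM_pred _ _) _.
  have [[gi _] [hi _]] := (gP i, hP (k - i)%N).
  by have := ltn_ord i; lia.
rewrite coefpsM raddf_sum; apply: eq_bigr => i _ /=.
by rewrite mevalM; have [[_ <-] [_ <-]] := (gP i, hP (k - i)%N).
Qed.

Lemma polyfam_prod (I : Type) (s : seq I) (G : I -> ('I_n -> K) -> fps K) :
  (forall i, polyfam (G i)) -> polyfam (fun x => \prod_(i <- s) G i x).
Proof.
move=> GP; elim: s => [|i s IHs].
  by have [h hP] := polyfam1; exists h => k; have [s1 s2] := hP k; split => // x;
     rewrite big_nil.
have [h hP] := polyfamM (GP i) IHs; exists h => k; have [s1 s2] := hP k.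
by split=> // x; rewrite big_cons.
Qed.

Lemma polyfam_scale (i : 'I_n) (f : fps K) : polyfam (fun x => fps_scale (x i) f).
Proof.
exists (fun k => coefps f k *: mpolyX K (mnm_muln (mnm1 i) k)) => k; split=> [|x].
  by rewrite (leq_trans (msizeZ_le _ _)) // msizeX mdegMn mdeg1 mul1n.
by rewrite mevalZ -mpolyXn rmorphXn /= mevalXU mulrC.
Qed.

End PolynomialFamily.

(** * The generating function P(z; x) and relation (1) *)

Section GeneratingFunction.
Variables (K : fieldType) (q t : K) (n : nat).
Hypothesis gen : generic q t.
(* F stands for the product (z)_oo, of which only this functional equation
   matters. *)
Variable F : fps K.
Hypothesis F0 : coefps F 0 = 1.
Hypothesis F_eq : F = (1 - fpsX) * fps_scale q F.
Implicit Types (u v w : multinom n.+1) (x : 'I_n.+1 -> K).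

Local Notation sp := (spectral q t).
Local Notation gb := (gbinom q t).

(** The polynomial S_u(z), with the factors of each row placed by its rank. *)
Definition spoly u : {poly K} :=
  \prod_(i < n.+1) \prod_(m < u i) (1 - (t ^+ spectral_exp u i * q ^+ m) *: 'X).

Lemma size_factor (y : K) : y != 0 -> size (1 - y *: 'X : {poly K}) = 2.
Proof.
move=> y0; rewrite -scaleN1r scalerA mulN1r addrC -mul_polyC -polyC1.
by rewrite size_MXaddC polyC_eq0 oppr_eq0 (negbTE y0) /= size_polyC oppr_eq0 y0.
Qed.

Lemma lead_coef_factor (y : K) : y != 0 -> lead_coef (1 - y *: 'X : {poly K}) = - y.
Proof.
move=> y0; rewrite lead_coefE size_factor //= coefB coefZ coefX coef1 mulr1.
by rewrite sub0r.
Qed.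

Lemma node_neq0 (a b : nat) : t ^+ a * q ^+ b != 0.
Proof.
by rewrite mulf_neq0 ?expf_neq0 ?(generic_q0 gen) ?(generic_t0 gen).
Qed.

Lemma spoly_neq0 u : spoly u != 0.
Proof.
apply/prodf_neq0 => i _; apply/prodf_neq0 => m _.
by rewrite -size_poly_gt0 size_factor ?node_neq0.
Qed.

Lemma spoly0 u : (spoly u)`_0 = 1.
Proof.
rewrite -horner_coef0 horner_prod big1 // => i _.
by rewrite horner_prod big1 // => m _; rewrite !hornerE subr0.
Qed.

Lemma size_spoly u : size (spoly u) = (mdeg u).+1.
Proof.
have row i : size (\prod_(m < u i)
    (1 - (t ^+ spectral_exp u i * q ^+ m) *: 'X : {poly K})) = (u i).+1.
  rewrite size_prod => [|m _]; last by rewrite -size_poly_gt0 size_factor ?node_neq0.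
  under eq_bigr => m _ do rewrite size_factor ?node_neq0 //.
  by rewrite sum_nat_const cardT size_enum_ord; lia.
rewrite size_prod => [|i _]; last by rewrite -size_poly_gt0 row.
under eq_bigr => i _ do rewrite row -addn1.
rewrite big_split /= sum_nat_const cardT size_enum_ord muln1 mdegE.
by rewrite -addSn addnK.
Qed.

Lemma lead_spoly u : lead_coef (spoly u) =
  (-1) ^+ mdeg u * t ^+ rank_weight u * q ^+ nstat' u.
Proof.
rewrite lead_coef_prod mdegE /rank_weight /nstat' !expr_sum -!big_split /=.
apply: eq_bigr => i _; rewrite lead_coef_prod.
under eq_bigr => m _ do rewrite lead_coef_factor ?node_neq0 // -mulN1r mulrA.
rewrite !big_split /= !prodr_const card_ord exprM -exprMn_comm; last exact: mulrC.
congr (_ * _); rewrite -(big_mkord xpredT (fun m => q ^+ m)) -expr_sum.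
by rewrite big_mkord -triangular_sum big_mkord.
Qed.

(** By [prod_rank] the factors are indexed by the squares of the partitions, so the quotient is the
    product over the squares of w^+ outside v^+. *)
Lemma spoly_dvd v w : (forall m, nparts v m <= nparts w m)%N ->
  exists2 Q, spoly w = spoly v * Q
    & size Q = (mdeg w - mdeg v).+1 /\ lead_coef Q = lead_coef (spoly w) / lead_coef (spoly v).
Proof.
move=> vw; pose M := (mdeg v + mdeg w)%N.
have ub u (uM : (mdeg u <= M)%N) (i : 'I_n.+1) : (u i <= M)%N.
  exact: leq_trans (mnm_le_mdeg u i) uM.
pose Fac k m : {poly K} := 1 - (t ^+ k * q ^+ m) *: 'X.
pose Q := \prod_(k < n.+1) \prod_(m < M |
  (n.+1 <= k + nparts w m)%N && ~~ (n.+1 <= k + nparts v m)%N) Fac k m.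
have wE : spoly w = spoly v * Q.
  rewrite /spoly (prod_rank Fac (ub v (leq_addr _ _))).
  rewrite (prod_rank Fac (ub w (leq_addl _ _))) -big_split; apply: eq_bigr => k _.
  rewrite (bigID (fun m : 'I_M => (n.+1 <= k + nparts v m)%N)) /=; congr (_ * _).
  apply: eq_bigl => m; rewrite andbC; case: leqP => //= /leq_trans; apply.
  by rewrite leq_add2l.
exists Q => //; have Q0 : Q != 0.
  by apply: contraNneq (spoly_neq0 w) => Q0; rewrite wE Q0 mulr0.
split; last by rewrite wE lead_coefM mulrC mulKf // lead_coef_eq0 spoly_neq0.
have := congr1 (fun p : {poly K} => size p) wE; rewrite size_mul ?spoly_neq0 // !size_spoly.
move: Q0; rewrite -size_poly_gt0; move: (size Q) => s s_gt0.
by move: (mdeg w) (mdeg v) => dw dv; lia.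
Qed.

(** Stands for (y z)_oo. *)
Definition qinf (y : K) := fps_scale y F.

Lemma qinf_unit y : qinf y \is a GRing.unit.
Proof. by rewrite fps_scale_unit fps_unitE F0 oner_eq0. Qed.

Lemma qinfM y k : qinf y =
  fps_poly (\prod_(m < k) (1 - (y * q ^+ m) *: 'X)) * qinf (y * q ^+ k).
Proof.
have step z : qinf z = fps_poly (1 - z *: 'X) * qinf (z * q).
  rewrite /qinf {1}F_eq rmorphM /= fps_scale_scale; congr (_ * _).
  apply: fpsP => -[|[|l]] /=; rewrite coefB coefZ coefX coef1 /=; ring.
elim: k => [|k IHk]; first by rewrite big_ord0 rmorph1 mul1r mulr1.
by rewrite {}IHk step big_ord_recr /= rmorphM -!mulrA exprSr.
Qed.

Definition Pnum := \prod_(k < n.+1) qinf (t ^+ k).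
Definition Pden x := \prod_(i < n.+1) (qinf (x i))^-1.

Lemma fps_spoly_unit u : fps_poly (spoly u) \is a GRing.unit.
Proof. by rewrite fps_unitE /= spoly0 oner_eq0. Qed.

(** Once the numerators are ordered by rank, each row is a quotient of infinite products that
    telescopes to a finite one. *)
Lemma Pnum_spectral w : Pnum * Pden (sp w) = fps_poly (spoly w).
Proof.
rewrite /Pnum (reindex_inj (@rank_ord_inj _ w)) -big_split rmorph_prod /=.
apply: eq_bigr => i _; rewrite (qinfM (t ^+ spectral_exp w i) (w i)).
by rewrite spectralE [q ^+ _ * _]mulrC mulrK // qinf_unit.
Qed.

Local Notation Mn := (interpMnorm q t).

Definition tau u := meval (sp u) (Mn u).

Lemma MnE u : Mn u = (q ^+ nstat' u * t ^+ nstat u / cprime q t u) *: interp_poly gen u.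
Proof. by rewrite /interpMnorm (interpME gen). Qed.

Lemma Mn_scale_neq0 u : q ^+ nstat' u * t ^+ nstat u / cprime q t u != 0.
Proof.
by rewrite !mulf_neq0 ?invr_neq0 ?cprime_neq0 ?expf_neq0 ?(generic_q0 gen) ?(generic_t0 gen).
Qed.

Lemma tauE u : tau u = lead_coef (spoly u).
Proof.
rewrite /tau MnE mevalZ lead_spoly; have [_ _ _ e] := interp_polyP gen u.
have c0 := cprime_neq0 gen u.
rewrite [q ^+ _ * _]mulrC -!mulrA [t ^+ _ * _]mulrC -!mulrA e.
by field.
Qed.

Lemma tau_neq0 u : tau u != 0.
Proof. by rewrite tauE lead_coef_eq0 spoly_neq0. Qed.

Lemma msize_Mn u : msize (Mn u) = (mdeg u).+1.
Proof.
by rewrite MnE msizeZ ?Mn_scale_neq0 // (interp_ok_msize gen (interp_polyP gen u)).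
Qed.

Lemma meval_Mn u w : meval (sp w) (Mn u) = gb w u * tau u.
Proof. by rewrite /gbinom divfK // tau_neq0. Qed.

Lemma gb_diag u : gb u u = 1.
Proof. by rewrite /gbinom divff // tau_neq0. Qed.

Lemma gb_eq0 u w : (mdeg w <= mdeg u)%N -> w != u -> gb w u = 0.
Proof.
move=> wu nwu; have [_ _ van _] := interp_polyP gen u.
by rewrite /gbinom MnE mevalZ van // mulr0 mul0r.
Qed.

Lemma gb_mdeg u w : gb w u != 0 -> (mdeg u <= mdeg w)%N.
Proof.
apply: contraR; rewrite -ltnNge => wu; rewrite gb_eq0 ?(ltnW wu) //.
by apply: contraTneq wu => ->; rewrite ltnn.
Qed.

Lemma gb_nparts v w : gb w v != 0 -> forall m, (nparts v m <= nparts w m)%N.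
Proof.
move=> nz; apply: (@extra_vanishing _ _ _ _ gen v w).
apply: contraNneq nz => e.
by rewrite /gbinom MnE mevalZ e mulr0 mul0r.
Qed.

Lemma meval_comb d N (c : multinom n.+1 -> K) w : (d < N)%N -> (mdeg w <= d)%N ->
  meval (sp w) (\sum_(u : bmultinom n.+1 N | mdeg u == d) c u *: Mn u) =
  if mdeg w == d then c w * tau w else 0.
Proof.
move=> dN wd; rewrite raddf_sum.
have E (u : bmultinom n.+1 N) : mdeg u == d ->
    meval (sp w) (c u *: Mn u) = if w == u then c w * tau w else 0.
  move=> /eqP ud; rewrite mevalZ meval_Mn; case: eqVneq => [->|nwu].
    by rewrite gb_diag mul1r.
  by rewrite gb_eq0 ?ud // mul0r mulr0.
rewrite (eq_bigr _ E); case: eqP => [ewd|nwd].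
  have wN : (mdeg w < N)%N by rewrite ewd.
  rewrite (bigD1 (BMultinom wN)) /= ?ewd ?eqxx // big1 ?addr0 // => u /andP[_].
  by rewrite bmeqP /= eq_sym => /negbTE ->.
by rewrite big1 // => u /eqP ud; case: eqP => // wu; case: nwd; rewrite wu.
Qed.

Lemma comb_unique d N (p : mpoly n.+1 K) (c : multinom n.+1 -> K) :
  (d < N)%N -> (msize p <= d.+1)%N ->
  (forall w, (mdeg w <= d)%N ->
     meval (sp w) p = if mdeg w == d then c w * tau w else 0) ->
  p = \sum_(u : bmultinom n.+1 N | mdeg u == d) c u *: Mn u.
Proof.
move=> dN szp val; apply/eqP; rewrite -subr_eq0; apply/eqP.
apply: (interp_unique gen (d := d.+1)) => [|w wd].
  apply: leq_trans (msizeD_le _ _) _; rewrite geq_max szp msizeN /=.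
  apply: msize_sum_le => u /eqP <-.
  by rewrite -(msize_Mn u) msizeZ_le.
by rewrite mevalB meval_comb // val // subrr.
Qed.

(** The factor of P(z; x) / S_v(z) that does not involve x. *)
Definition Dcoef v := Pnum / fps_poly (spoly v).

Lemma Dcoef0 v : coefps (Dcoef v) 0 = 1.
Proof.
have c0M (f g : fps K) : coefps (f * g) 0 = coefps f 0 * coefps g 0.
  by rewrite coefpsM big_ord1.
have := c0M (Dcoef v) (fps_poly (spoly v)).
rewrite divrK ?fps_spoly_unit //= spoly0 mulr1 => <-.
rewrite /Pnum; elim/big_ind: _ => // [f g fE gE|k _]; first by rewrite c0M fE gE mulr1.
by rewrite /= mul1r.
Qed.

Lemma Pden_polyfam : polyfam Pden.
Proof.
apply: polyfam_prod => i.
have [h hP] := polyfam_scale i F^-1; exists h => k; have [sz ev] := hP k.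
split=> // x; rewrite -ev /qinf rmorphV //.
by rewrite fps_unitE F0 oner_eq0.
Qed.

Definition hpoly : nat -> mpoly n.+1 K := sval (cid Pden_polyfam).

Lemma hpolyP k : (msize (hpoly k) <= k.+1)%N /\
  forall x, coefps (Pden x) k = meval x (hpoly k).
Proof. exact: (svalP (cid Pden_polyfam)). Qed.

(** The coefficient of z^k in M_v(x) P(z; x) / S_v(z), as a polynomial in x. *)
Definition gpoly v k : mpoly n.+1 K :=
  Mn v * \sum_(i < k.+1) coefps (Dcoef v) (k - i) *: hpoly i.

Lemma meval_gpoly v k x : meval x (gpoly v k) =
  meval x (Mn v) * coefps (Pnum * Pden x / fps_poly (spoly v)) k.
Proof.
rewrite mevalM mulrAC [Pnum / _ * _]mulrC coefpsM raddf_sum; congr (_ * _).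
apply: eq_bigr => i _ /=; rewrite mevalZ mulrC.
by have [_ ->] := hpolyP i.
Qed.

Lemma gpolyE v k N : (mdeg v + k < N)%N -> gpoly v k =
  \sum_(u : bmultinom n.+1 N | mdeg u == (mdeg v + k)%N) gb u v *: Mn u.
Proof.
move=> kN; apply: (comb_unique kN (c := gb^~ v)) => [|w wd].
  apply: leq_trans (msizeM_pred _ _) _; rewrite msize_Mn addSn /= -addnS leq_add2l.
  apply: msize_sum_le => i _; apply: leq_trans (msizeZ_le _ _) _.
  by have [sz _] := hpolyP i; apply: leq_trans sz _; rewrite ltn_ord.
rewrite meval_gpoly Pnum_spectral meval_Mn.
have [->|nz] := eqVneq (gb w v) 0; first by rewrite !mul0r if_same.
have [Q wE [szQ leadQ]] := spoly_dvd (gb_nparts nz).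
have vw := gb_mdeg nz.
have -> : fps_poly (spoly w) / fps_poly (spoly v) = fps_poly Q.
  by rewrite wE rmorphM /= mulrC mulKr ?fps_spoly_unit.
rewrite [coefps _ _]/=.
(* Q has degree |w| - |v| <= k, so its coefficient at k is the leading one or zero. *)
case: eqP => [ewd|/eqP nwd].
  have -> : Q`_k = lead_coef Q by rewrite lead_coefE szQ ewd addKn.
  by rewrite leadQ -!tauE; have tv := tau_neq0 v; field.
by rewrite nth_default ?mulr0 // szQ; move: wd nwd; lia.
Qed.

Lemma q_binomial v k N x : (mdeg v + k < N)%N ->
  meval x (Mn v) * coefps (Pnum * Pden x / fps_poly (spoly v)) k =
  \sum_(u : bmultinom n.+1 N | mdeg u == (mdeg v + k)%N) gb u v * meval x (Mn u).
Proof.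
move=> kN; rewrite -meval_gpoly (gpolyE kN) raddf_sum.
by apply: eq_bigr => u _ /=; rewrite mevalZ.
Qed.

(** The top degree part of (1): only the constant term 1 of [Dcoef v] reaches degree |v| + k. *)
Lemma msize_top v k N : (mdeg v + k < N)%N ->
  (msize (Mn v * hpoly k -
    \sum_(u : bmultinom n.+1 N | mdeg u == (mdeg v + k)%N) gb u v *: Mn u)
   <= mdeg v + k)%N.
Proof.
move=> kN; rewrite -(gpolyE kN) -mulrBr.
rewrite big_ord_recr.
have -> : coefps (Dcoef v) (k - (ord_max : 'I_k.+1)) = 1.
  by rewrite (subnn k : (k - (ord_max : 'I_k.+1))%N = 0%N) Dcoef0.
rewrite scale1r opprD addrCA subrr addr0.
apply: leq_trans (msizeM_pred _ _) _; rewrite msize_Mn msizeN addSn /= leq_add2l.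
apply: msize_sum_le => i _; apply: leq_trans (msizeZ_le _ _) _.
by have [sz _] := hpolyP i; apply: leq_trans sz _; rewrite ltn_ord.
Qed.

(** Both sides are the coefficient of M_w in M_v h_k h_l modulo lower degree, multiplying by h_k
    first or by h_l first. *)
Lemma gb_comm v w k l N : mdeg w = (mdeg v + k + l)%N -> (mdeg w < N)%N ->
  \sum_(u : bmultinom n.+1 N | mdeg u == (mdeg v + k)%N) gb w u * gb u v =
  \sum_(u : bmultinom n.+1 N | mdeg u == (mdeg v + l)%N) gb w u * gb u v.
Proof.
move=> wd wN; set d := (mdeg v + k + l)%N in wd.
have dN : (d < N)%N by rewrite -wd.
pose c j (y : multinom n.+1) :=
  \sum_(u : bmultinom n.+1 N | mdeg u == (mdeg v + j)%N) gb y u * gb u v.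
pose C j := \sum_(y : bmultinom n.+1 N | mdeg y == d) c j y *: Mn y.
have small j l' : (mdeg v + j + l')%N = d ->
    (msize (Mn v * hpoly j * hpoly l' - C j) <= d)%N.
  move=> jl; have jN : (mdeg v + j < N)%N by lia.
  pose B := \sum_(u : bmultinom n.+1 N | mdeg u == (mdeg v + j)%N) gb u v *: Mn u.
  have -> : Mn v * hpoly j * hpoly l' - C j = (Mn v * hpoly j - B) * hpoly l' +
      \sum_(u : bmultinom n.+1 N | mdeg u == (mdeg v + j)%N) gb u v *:
        (Mn u * hpoly l' - \sum_(y : bmultinom n.+1 N | mdeg y == d) gb y u *: Mn y).
    have -> : C j = \sum_(u : bmultinom n.+1 N | mdeg u == (mdeg v + j)%N)
        gb u v *: \sum_(y : bmultinom n.+1 N | mdeg y == d) gb y u *: Mn y.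
      under [RHS]eq_bigr => u _ do rewrite scaler_sumr.
      rewrite exchange_big; apply: eq_bigr => y _; rewrite scaler_suml.
      by apply: eq_bigr => u _; rewrite scalerA mulrC.
    rewrite mulrBl (_ : B * hpoly l' = \sum_(u : bmultinom n.+1 N |
        mdeg u == (mdeg v + j)%N) gb u v *: (Mn u * hpoly l')).
      rewrite -addrA; congr (_ + _).
      rewrite -sumrN -sumrN -big_split; apply: eq_bigr => u _ /=.
      by rewrite scalerBr addrA addNr add0r.
    by rewrite mulr_suml; apply: eq_bigr => u _; rewrite scalerAl.
  apply: leq_trans (msizeD_le _ _) _; rewrite geq_max; apply/andP; split.
    apply: leq_trans (msizeM_pred _ _) _.
    by have := msize_top jN; have [sz _] := hpolyP l'; rewrite -/B; lia.
  apply: msize_sum_le => u /eqP ud; apply: leq_trans (msizeZ_le _ _) _.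
  have -> : d = (mdeg u + l')%N by rewrite ud.
  by apply: msize_top; rewrite ud jl.
(* The difference has degree less than d and, as a combination of M_y with |y| = d, vanishes at all
   points of degree less than d. *)
have eqC : C k - C l = 0.
  apply: (interp_unique gen (d := d)) => [|y yd]; last first.
    by rewrite mevalB !meval_comb ?(ltnW yd) // (ltn_eqF yd) subrr.
  have -> : C k - C l = (Mn v * hpoly l * hpoly k - C l) -
                        (Mn v * hpoly k * hpoly l - C k) by ring.
  apply: leq_trans (msizeD_le _ _) _; rewrite geq_max msizeN.
  by rewrite !small // /d; lia.
have := congr1 (meval (sp w)) eqC; rewrite mevalB meval0 !meval_comb ?wd //.
by rewrite eqxx -mulrBl => /eqP; rewrite mulf_eq0 (negbTE (tau_neq0 w)) orbF subr_eq0 => /eqP.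
Qed.

End GeneratingFunction.
(** * Heine's transformation *)

Section Transformation.
Variables (K : fieldType) (q t : K) (n : nat).
Hypothesis gen : generic q t.
Variable F : fps K.
Hypothesis F0 : coefps F 0 = 1.
Hypothesis F_eq : F = (1 - fpsX) * fps_scale q F.
Implicit Types (u v w y : multinom n.+1) (x : 'I_n.+1 -> K) (a b c A : K).

Local Notation sp := (spectral q t).
Local Notation gb := (gbinom q t).
Local Notation Mn := (interpMnorm q t).
Local Notation S := (spoly q t).
Local Notation P x := (Pnum t n F * Pden F x).
Local Notation bm N := (bmultinom n.+1 N).

Lemma sum_by_degree N d (G : multinom n.+1 -> K) :
  (forall u, (mdeg u < d)%N -> G u = 0) ->
  \sum_(u : bm N) G u =
  \sum_(k < N - d) \sum_(u : bm N | mdeg u == (d + k)%N) G u.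
Proof.
move=> G0; rewrite (exchange_big_dep xpredT) //=; apply: eq_bigr => u _.
have [ud|du] := ltnP (mdeg u) d.
  by rewrite G0 // big1.
have lt_k : (mdeg u - d < N - d)%N by have := bmdeg u; lia.
by rewrite (big_pred1 (Ordinal lt_k)) // => k; rewrite /= -val_eqE /=; lia.
Qed.

(** Relation (1) at x = <w>, where the series is the polynomial S_w / S_v and z may be given the
    value b. *)
Lemma q_binomial_horner v w b N : (mdeg w < N)%N ->
  gb w v * tau q t v * (S w).[b] =
  (S v).[b] * \sum_(u : bm N)
    b ^+ (mdeg u - mdeg v) * (gb u v * (gb w u * tau q t u)).
Proof.
move=> wN; have [Nv|vN] := leqP N (mdeg v).
  rewrite gb_eq0 ?(ltnW (leq_trans wN Nv)) //; last first.
    by apply: contraTneq wN => ->; rewrite -leqNgt.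
  rewrite big1 ?mulr0 ?mul0r // => u _; have uN := bmdeg u.
  rewrite (@gb_eq0 _ _ _ _ gen v u) ?mul0r ?mulr0 ?(ltnW (leq_trans uN Nv)) //.
  by apply: contraTneq uN => ->; rewrite -leqNgt.
rewrite (@sum_by_degree N (mdeg v) (fun u => b ^+ (mdeg u - mdeg v) *
  (gb u v * (gb w u * tau q t u)))) => [|u uv]; last first.
  rewrite gb_eq0 ?mul0r ?mulr0 ?(ltnW uv) //.
  by apply: contraTneq uv => ->; rewrite ltnn.
have R k : (k < N - mdeg v)%N ->
    \sum_(u : bm N | mdeg u == (mdeg v + k)%N)
      b ^+ (mdeg u - mdeg v) * (gb u v * (gb w u * tau q t u)) =
    gb w v * tau q t v * coefps (fps_poly (S w) / fps_poly (S v)) k * b ^+ k.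
  move=> kN; have vkN : (mdeg v + k < N)%N by lia.
  rewrite -(meval_Mn gen) -(Pnum_spectral t F0 F_eq w).
  rewrite (q_binomial gen F0 F_eq _ vkN) mulr_suml.
  by apply: eq_bigr => u /eqP ->; rewrite addKn (meval_Mn gen) mulrC.
rewrite (eq_bigr (fun k : 'I_(N - mdeg v) => gb w v * tau q t v *
  coefps (fps_poly (S w) / fps_poly (S v)) k * b ^+ k)); last first.
  by move=> k _; exact: R.
have [->|nz] := eqVneq (gb w v) 0.
  by rewrite !mul0r big1 ?mulr0 // => k _; rewrite !mul0r.
have [Q wE [szQ _]] := spoly_dvd gen (gb_nparts gen nz).
have -> : fps_poly (S w) / fps_poly (S v) = fps_poly Q.
  by rewrite wE rmorphM /= mulrC mulKr ?fps_spoly_unit.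
have szQ' : (size Q <= N - mdeg v)%N by rewrite szQ; have := gb_mdeg gen nz; lia.
rewrite wE hornerM (horner_coef_wide b szQ') mulrCA; congr (_ * _).
by rewrite mulr_sumr; apply: eq_bigr => k _; rewrite mulrA.
Qed.

(** Relation (2) without negative powers: reverse the degrees between |y| and |w| and apply
    [gb_comm] in each. *)
Lemma gb_reflect w y A N : (mdeg w < N)%N ->
  \sum_(u : bm N) A ^+ mdeg u * (gb w u * gb u y) =
  A ^+ mdeg y * \sum_(u : bm N) A ^+ (mdeg w - mdeg u) * (gb w u * gb u y).
Proof.
move=> wN.
have out u : gb w u * gb u y != 0 -> (mdeg y <= mdeg u <= mdeg w)%N.
  by rewrite mulf_eq0 negb_or => /andP[/(gb_mdeg gen) -> /(gb_mdeg gen) ->].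
have [wy|yw] := ltnP (mdeg w) (mdeg y).
  have z u : gb w u * gb u y = 0 by apply: contraTeq wy => /out; lia.
  by rewrite !big1 ?mulr0 // => u _; rewrite z mulr0.
pose D := (mdeg w - mdeg y)%N.
have cut (e : nat -> nat) : \sum_(u : bm N) A ^+ e (mdeg u) * (gb w u * gb u y) =
    \sum_(k < D.+1) A ^+ e (mdeg y + k)%N *
      \sum_(u : bm N | mdeg u == (mdeg y + k)%N) gb w u * gb u y.
  rewrite (@sum_by_degree N (mdeg y) (fun u => A ^+ e (mdeg u) *
    (gb w u * gb u y))) => [|u uy]; last first.
    by have [->|/out] := eqVneq (gb w u * gb u y) 0; [rewrite mulr0 | lia].
  have DN : (D < N - mdeg y)%N by rewrite /D; lia.
  rewrite -(big_mkord xpredT (fun k => \sum_(u : bm N | mdeg u == (mdeg y + k)%N)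
    A ^+ e (mdeg u) * (gb w u * gb u y))) (big_cat_nat _ DN) //=.
  rewrite [X in _ + X]big_nat_cond [X in _ + X]big1 ?addr0 => [|k].
    rewrite big_mkord; apply: eq_bigr => k _; rewrite mulr_sumr.
    by apply: eq_bigr => u /eqP ->.
  case/andP=> /andP[Dk _] _; apply: big1 => u /eqP uk.
  have [->|/out] := eqVneq (gb w u * gb u y) 0; first by rewrite mulr0.
  by move: Dk; rewrite /D; lia.
rewrite (cut id) (cut (fun d => mdeg w - d)%N) (reindex_inj rev_ord_inj) mulr_sumr.
apply: eq_bigr => k _; have := ltn_ord k; rewrite ltnS => kD /=.
rewrite mulrA -exprD subSS.
have -> : (mdeg w - (mdeg y + k) = D - k)%N by rewrite /D; lia.
congr (_ * _); apply: (gb_comm gen F0 F_eq) => //; rewrite /D in kD *; lia.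
Qed.

(** Expand S_u(b) over y by [q_binomial_horner], so that the sum over u is the one of [gb_reflect];
    the power of A released there turns b^(|y|-|v|) into (A b)^(|y|-|v|), and the expansion is
    summed back. *)
Lemma gb_heine v w A b N : (mdeg w < N)%N ->
  (S v).[A * b] * \sum_(u : bm N) A ^+ mdeg u * ((S u).[b] * (gb w u * gb u v)) =
  (S v).[b] * A ^+ mdeg v *
  \sum_(u : bm N) A ^+ (mdeg w - mdeg u) * ((S u).[A * b] * (gb w u * gb u v)).
Proof.
move=> wN; apply: (mulIf (tau_neq0 gen v)).
pose T e y := gb y v * tau q t y * e ^+ (mdeg y - mdeg v).
have expand (e : nat -> nat) d :
    (\sum_(u : bm N) A ^+ e (mdeg u) * ((S u).[d] * (gb w u * gb u v))) * tau q t v =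
    (S v).[d] * \sum_(y : bm N) T d y *
      \sum_(u : bm N) A ^+ e (mdeg u) * (gb w u * gb u y).
  rewrite mulr_suml mulr_sumr.
  under [RHS]eq_bigr => y _ do rewrite mulr_sumr mulr_sumr.
  rewrite exchange_big; apply: eq_bigr => u _ /=.
  transitivity (A ^+ e (mdeg u) * gb w u * (gb u v * tau q t v * (S u).[d])).
    by ring.
  rewrite (q_binomial_horner v d (bmdeg u)) !mulr_sumr; apply: eq_bigr => y _.
  by rewrite /T; ring.
have e1 := expand (fun d => d) b; have e2 := expand (fun d => mdeg w - d)%N (A * b).
rewrite /= in e1 e2; rewrite -[LHS]mulrA e1 -[RHS]mulrA e2.
rewrite mulrCA -!mulrA; congr (_ * _); rewrite [RHS]mulrCA; congr (_ * _).
rewrite mulr_sumr; apply: eq_bigr => y _; rewrite (gb_reflect y A wN).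
rewrite /T exprMn.
have [->|nz] := eqVneq (gb y v) 0; first by ring.
have -> : A ^+ mdeg y = A ^+ mdeg v * A ^+ (mdeg y - mdeg v).
  by rewrite -exprD subnKC ?(gb_mdeg gen nz).
by ring.
Qed.

(** Here [b] is the parameter of the theorem divided by [t ^+ n], which turns (b)_u into S_u(b). *)
Definition heine_term v x a b c u : fps K :=
  (a ^+ mdeg u * (S u).[b] * (gb u v * meval x (Mn u)))%:S
  * (fpsX ^+ mdeg u / fps_scale c (fps_poly (S u))).

Lemma coefpsXnM d (f : fps K) k :
  coefps (fpsX ^+ d * f) k = if (k < d)%N then 0 else coefps f (k - d).
Proof.
elim: d k => [|d IHd] k; first by rewrite mul1r subn0.
rewrite exprS -mulrA coefpsM; case: k => [|k].
  by rewrite big_ord1 [coefps fpsX _]mulr0n mul0r.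
rewrite big_ord_recl [coefps fpsX _]mulr0n mul0r add0r big_ord_recl.
rewrite [coefps fpsX _]mulr1n mul1r big1 ?addr0 => [|i _].
  by rewrite (_ : k.+1 - lift _ _ = k)%N ?IHd ?subSS // -[RHS]subn0.
by rewrite [coefps fpsX _]mulr0n mul0r.
Qed.

(** P(cz; x) combines with each denominator S_u(cz), and (1) expands the result in the M_w. *)
Lemma coefps_heine_sum v x a b c k N : (k < N)%N ->
  coefps ((\sum_(u : bm N) heine_term v x a b c u) * fps_scale c (P x)) k =
  \sum_(w : bm N | mdeg w == k) meval x (Mn w) *
    (\sum_(u : bm N) a ^+ mdeg u * c ^+ (k - mdeg u) *
       ((S u).[b] * (gb w u * gb u v))).
Proof.
move=> kN; rewrite mulr_suml coefps_sum.
under [in RHS]eq_bigr => w _ do rewrite mulr_sumr.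
rewrite [RHS]exchange_big; apply: eq_bigr => u _.
rewrite /heine_term -mulrA coefpsCM -[fpsX ^+ _ / _ * _]mulrA coefpsXnM.
have -> : (fps_scale c (fps_poly (S u)))^-1 * fps_scale c (P x) =
    fps_scale c (P x / fps_poly (S u)).
  by rewrite [RHS]rmorphM /= rmorphV ?fps_spoly_unit //= mulrC.
case: ltnP => [ku|uk].
  rewrite mulr0 big1 // => w /eqP wk.
  rewrite (@gb_eq0 _ _ _ _ gen u w) ?wk ?(ltnW ku) ?mul0r ?mulr0 //.
  by apply: contraTneq ku => <-; rewrite wk ltnn.
have ukN : (mdeg u + (k - mdeg u) < N)%N by rewrite subnKC.
rewrite coefps_scale.
transitivity (a ^+ mdeg u * c ^+ (k - mdeg u) * (S u).[b] * gb u v *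
  (meval x (Mn u) * coefps (P x / fps_poly (S u)) (k - mdeg u))); first by ring.
rewrite (q_binomial gen F0 F_eq x ukN) subnKC // mulr_sumr.
by apply: eq_bigr => w _; ring.
Qed.

Lemma heine_sum v x a b c N k : (k < N)%N -> c != 0 ->
  (S v).[a / c * b] != 0 ->
  coefps ((\sum_(u : bm N) heine_term v x a b c u) * fps_scale c (P x)) k =
  (a / c) ^+ mdeg v * ((S v).[b] / (S v).[a / c * b]) *
  coefps ((\sum_(u : bm N) heine_term v x c (a / c * b) a u)
          * fps_scale a (P x)) k.
Proof.
move=> kN c0 Sv0; rewrite !coefps_heine_sum // mulr_sumr.
apply: eq_bigr => w /eqP wk; rewrite [RHS]mulrCA; congr (_ * _).
have wN : (mdeg w < N)%N by rewrite wk.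
set A := a / c in Sv0 *; have aE : a = A * c by rewrite divfK.
have le_uk u : gb w u != 0 -> (mdeg u <= k)%N by rewrite -wk; exact: gb_mdeg.
have -> : \sum_(u : bm N) a ^+ mdeg u * c ^+ (k - mdeg u) *
    ((S u).[b] * (gb w u * gb u v)) =
    c ^+ k * \sum_(u : bm N) A ^+ mdeg u * ((S u).[b] * (gb w u * gb u v)).
  rewrite mulr_sumr; apply: eq_bigr => u _.
  have [->|/le_uk uk] := eqVneq (gb w u) 0; first by ring.
  by rewrite -{2}(subnKC uk) aE exprMn exprD; ring.
have -> : \sum_(u : bm N) c ^+ mdeg u * a ^+ (k - mdeg u) *
    ((S u).[A * b] * (gb w u * gb u v)) =
    c ^+ k * \sum_(u : bm N) A ^+ (mdeg w - mdeg u) *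
      ((S u).[A * b] * (gb w u * gb u v)).
  rewrite mulr_sumr; apply: eq_bigr => u _; rewrite wk.
  have [->|/le_uk uk] := eqVneq (gb w u) 0; first by ring.
  by rewrite -{2}(subnKC uk) aE exprMn exprD; ring.
rewrite mulrCA; congr (_ * _); apply: (mulfI Sv0).
by rewrite (gb_heine v A b wN); field.
Qed.

Lemma coefps_fps_sum (G : multinom n.+1 -> fps K) k N :
  (forall u, (k < mdeg u)%N -> coefps (G u) k = 0) -> (k < N)%N ->
  coefps (fps_sum G) k = coefps (\sum_(u : bm N) G u) k.
Proof.
move=> G0 kN; rewrite coefps_sum.
rewrite -(big_map (fun u : bm N => u : multinom n.+1) xpredT
  (fun u => coefps (G u) k)).
rewrite (@bigfs _ _ _ _ _ xpredT (fun u => coefps (G u) k)).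
- by rewrite [LHS]/=; apply: eq_fsbigl; apply/seteqP; split.
- by rewrite map_inj_uniq ?index_enum_uniq //; exact: val_inj.
- move=> u _; apply: contraNeq => nz.
  have uN : (mdeg u < N)%N.
    rewrite (leq_ltn_trans _ kN) // leqNgt; apply: contraNN nz => ku.
    by rewrite G0.
  by apply/mapP; exists (BMultinom uN); rewrite ?mem_index_enum.
Qed.

Lemma heine_term_small v x a b c u k : (k < mdeg u)%N ->
  coefps (heine_term v x a b c u) k = 0.
Proof. by move=> ku; rewrite /heine_term coefpsCM coefpsXnM ku mulr0. Qed.

(** P(cz; x) is invertible, so it may be multiplied out; the coefficient of z^k then needs only the
    u with |u| <= k. *)
Lemma heine_fps_sum v x a b c : c != 0 -> (S v).[a / c * b] != 0 ->
  fps_sum (heine_term v x a b c) =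
  ((a / c) ^+ mdeg v * ((S v).[b] / (S v).[a / c * b]))%:S
  * (fps_scale a (P x) / fps_scale c (P x))
  * fps_sum (heine_term v x c (a / c * b) a).
Proof.
move=> c0 Sv0.
have Pu : fps_scale c (P x) \is a GRing.unit.
  rewrite fps_scale_unit unitrM; apply/andP; split; rewrite unitr_prod // => i _.
    exact: qinf_unit F0 _.
  by rewrite unitrV; exact: qinf_unit F0 _.
have e (C Pa Pc T : fps K) : C * (Pa / Pc) * T * Pc = C * (T * Pa * (Pc^-1 * Pc)).
  by ring.
apply: (mulIr Pu); rewrite e mulVr // mulr1.
apply: fpsP => k; rewrite coefpsCM.
have trunc a' b' c' (f : fps K) :
    coefps (fps_sum (heine_term v x a' b' c') * f) k =
    coefps ((\sum_(u : bm k.+1) heine_term v x a' b' c' u) * f) k.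
  rewrite !coefpsM; apply: eq_bigr => i _; congr (_ * _).
  by apply: coefps_fps_sum => // u; exact: heine_term_small.
by rewrite !trunc heine_sum.
Qed.

End Transformation.
(** * The infinite product as a coefficientwise limit *)

Section InfiniteProduct.
Variable K : fieldType.
Implicit Types (q y z : K) (N k : nat).

Lemma fpsC_additive : additive (@fpsC K).
Proof. by move=> y z; apply: fpsP => k /=; rewrite mulrnBl. Qed.

Lemma fpsC_multiplicative : multiplicative (@fpsC K).
Proof.
split=> // y z; apply: fpsP => k; rewrite coefpsCM /=.
by rewrite -mulrnAr.
Qed.

HB.instance Definition _ := GRing.isAdditive.Build K (fps K) (@fpsC K) fpsC_additive.
HB.instance Definition _ :=
  GRing.isMultiplicative.Build K (fps K) (@fpsC K) fpsC_multiplicative.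

Lemma fps_poly_factor y : fps_poly (1 - y *: 'X) = 1 - fpsX * y%:S.
Proof.
apply: fpsP => k; rewrite [fpsX * _]mulrC.
rewrite -[coefps (1 - _) k]/(coefps 1 k - coefps (y%:S * fpsX) k) coefpsCM.
by rewrite /= coefB coefZ coefX coef1.
Qed.

Lemma qpoch_fps q y N : qpoch q%:S (fpsX * y%:S) N =
  fps_poly (\prod_(m < N) (1 - (y * q ^+ m) *: 'X)).
Proof.
rewrite rmorph_prod; apply: eq_bigr => m _ /=.
by rewrite fps_poly_factor -mulrA rmorphM rmorphXn.
Qed.

(** Euler's coefficients (-1)^k q^(k(k-1)/2) / (q)_k of (z)_oo. *)
Definition qinf_coef q k := \prod_(i < k) (- q ^+ i / (1 - q ^+ i.+1)).

Lemma qinf_coefS q k : 1 - q ^+ k.+1 != 0 ->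
  qinf_coef q k.+1 * (1 - q ^+ k.+1) = - q ^+ k * qinf_coef q k.
Proof. by move=> nz; rewrite /qinf_coef big_ord_recr /= -mulrA divfK // mulrC. Qed.

Definition qinf_fps q : fps K := Fps (qinf_coef q).

Lemma qinf_fps_eq q : (forall k, 1 - q ^+ k.+1 != 0) ->
  qinf_fps q = (1 - fpsX) * fps_scale q (qinf_fps q).
Proof.
move=> nz; apply: fpsP => -[|k].
  by rewrite coefpsM big_ord1 /=; ring.
rewrite mulrBl mul1r -{1}(expr1 (@fpsX K)).
rewrite -[coefps (_ - _) k.+1]/(coefps (fps_scale q (qinf_fps q)) k.+1 -
  coefps (fpsX ^+ 1 * fps_scale q (qinf_fps q)) k.+1) coefpsXnM /= subn1 /=.
have := qinf_coefS (nz k); rewrite mulrBr mulr1 mulNr => e.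
transitivity (q ^+ k.+1 * qinf_coef q k.+1 +
  (qinf_coef q k.+1 - qinf_coef q k.+1 * q ^+ k.+1)); first by ring.
by rewrite e.
Qed.

(** Compare coefficients in (yz)_N (1 - y q^N z) = (1 - yz) (yqz)_N. *)
Lemma coef_qprod q y N k :
  let p z : {poly K} := \prod_(m < N) (1 - (z * q ^+ m) *: 'X) in
  (1 - q ^+ k.+1) * (p y)`_k.+1 = y * (q ^+ N - q ^+ k) * (p y)`_k.
Proof.
move=> p.
have scale : fps_poly (p (y * q)) = fps_scale q (fps_poly (p y)).
  rewrite !rmorph_prod; apply: eq_bigr => m _; apply: fpsP => -[|[|l]] /=;
    by rewrite !coefB !coefZ !coefX !coef1 /=; ring.
have shift : p y * (1 - (y * q ^+ N) *: 'X) = (1 - y *: 'X) * p (y * q).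
  transitivity (\prod_(m < N.+1) (1 - (y * q ^+ m) *: 'X)).
    by rewrite big_ord_recr.
  rewrite big_ord_recl /= mulr1; congr (_ * _).
  by apply: eq_bigr => m _; rewrite /= exprS mulrA.
have coefE j : (p (y * q))`_j = q ^+ j * (p y)`_j.
  by have /(congr1 (fun f => coefps f j)) := scale.
have := congr1 (fun r : {poly K} => r`_k.+1) shift.
rewrite mulrBr mulrBl mulr1 mul1r !coefB -scalerAr -scalerAl !coefZ.
rewrite coefMX coefXM /= !coefE => e.
transitivity (((p y)`_k.+1 - y * q ^+ N * (p y)`_k) - q ^+ k.+1 * (p y)`_k.+1
  + y * q ^+ N * (p y)`_k); first by ring.
by rewrite e; ring.
Qed.

End InfiniteProduct.

(** * Convergence of the finite products *)

Section QpochLimit.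
Variables (K : numFieldType) (q : K).
Hypothesis q_cvg : (q ^+ N @[N --> \oo] --> (0 : K))%classic.
Hypothesis nz : forall k, 1 - q ^+ k.+1 != 0.

(** By induction on k: as q^N tends to 0, the recursion [coef_qprod] becomes that of [qinf_coef]. *)
Lemma qpoch_infty_scale (y : K) :
  qpoch_infty q (fpsX * y%:S) = fps_scale y (qinf_fps q).
Proof.
apply: fpsP => k; apply: cvg_lim; first exact: norm_hausdorff.
elim: k => [|k IHk].
  have e N : coefps (qpoch q%:S (fpsX * y%:S) N) 0 = 1.
    rewrite qpoch_fps /= -horner_coef0 horner_prod big1 // => m _.
    by rewrite !hornerE subr0.
  rewrite (eq_cvg _ _ e) /= mul1r /qinf_coef big_ord0; exact: cvg_cst.
have e N : coefps (qpoch q%:S (fpsX * y%:S) N) k.+1 =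
    y / (1 - q ^+ k.+1) * (q ^+ N - q ^+ k) *
    coefps (qpoch q%:S (fpsX * y%:S) N) k.
  rewrite qpoch_fps /=; have := coef_qprod q y N k => /= e.
  by apply: (mulfI (nz k)); rewrite e; field; exact: nz.
rewrite (eq_cvg _ _ e).
have -> : coefps (fps_scale y (qinf_fps q)) k.+1 =
    y / (1 - q ^+ k.+1) * (0 - q ^+ k) * coefps (fps_scale y (qinf_fps q)) k.
  rewrite !coefps_scale; apply: (mulIf (nz k)) => /=.
  transitivity (y ^+ k.+1 * (qinf_coef q k.+1 * (1 - q ^+ k.+1))); first by ring.
  by rewrite qinf_coefS // (exprS y); field; exact: nz.
apply: cvgM; last exact: IHk.
apply: cvgMl_tmp; apply: cvgB; first exact: q_cvg.
exact: cvg_cst.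
Qed.

End QpochLimit.

Section ComplexLimit.
Variable R : realType.
Implicit Types (q y : R[i]).

Lemma cvg_exp_complex q : `|q| < 1 -> ((q : (R[i] : numFieldType)) ^+ N @[N --> \oo] -->
                                  (0 : (R[i] : numFieldType)))%classic.
Proof.
move=> q1; pose r := complex.Re `|q|.
have qE : `|q| = r%:C%C by rewrite /r normc_def.
have r0 : 0 <= r by rewrite -lecR -qE normr_ge0.
have r1 : `|r| < 1 by rewrite ger0_norm // -ltcR -qE.
apply/cvgr0Pnorm_lt => e e0.
have eE : e = (complex.Re e)%:C%C by rewrite RRe_real // gtr0_real.
have e0' : 0 < complex.Re e by rewrite -ltcR -eE.
have /cvgr0Pnorm_lt/(_ _ e0') := cvg_expr r1.
apply: filterS => N; rewrite ger0_norm ?exprn_ge0 // => lt_re.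
by rewrite normrX qE eE -rmorphXn ltcR.
Qed.

End ComplexLimit.

(** * Translation between the shifted factorials and S_u *)

Section Specialization.
Variables (K : fieldType) (q t : K) (n : nat).
Hypothesis gen : generic q t.
Implicit Types (u v : multinom n.+1) (b c y z : K).

Lemma horner_factor y z : (1 - y *: 'X).[z] = 1 - y * z :> K.
Proof. by rewrite !hornerE. Qed.

Lemma qpoch_comp_spoly b u : qpoch_comp q t b u = (spoly q t u).[b / t ^+ n].
Proof.
rewrite qpoch_comp_rank horner_prod; apply: eq_bigr => i _.
rewrite horner_prod; apply: eq_bigr => m _; rewrite horner_factor subSS.
congr (1 - _); have := rank_lt u i; rewrite ltnS => rn.
have t0 := generic_t0 gen.
have -> : t ^+ n = t ^+ (n - spectral_exp u i) * t ^+ spectral_exp u i.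
  by rewrite -exprD subnK.
by field; rewrite !expf_neq0.
Qed.

Lemma qpoch_comp_fps c u :
  qpoch_comp q%:S t%:S (fpsX * c%:S * t%:S ^+ n) u =
  fps_scale c (fps_poly (spoly q t u)).
Proof.
rewrite qpoch_comp_rank !rmorph_prod; apply: eq_bigr => i _.
rewrite !rmorph_prod; apply: eq_bigr => m _ /=.
have -> : fps_scale c (fps_poly (1 - (t ^+ spectral_exp u i * q ^+ m) *: 'X)) =
    fps_poly (1 - (c * (t ^+ spectral_exp u i * q ^+ m)) *: 'X).
  by apply: fpsP => -[|[|l]] /=; rewrite !coefB !coefZ !coefX !coef1 /=; ring.
have := rank_lt u i; rewrite ltnS => rn.
have tU k : (t%:S ^+ k : fps K) \is a GRing.unit.
  by rewrite unitrX // fps_unitE /= mulr1n (generic_t0 gen).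
rewrite fps_poly_factor subSS; congr (1 - _).
have -> : (t%:S ^+ n : fps K) = t%:S ^+ spectral_exp u i * t%:S ^+ (n - spectral_exp u i).
  by rewrite -exprD subnKC.
by rewrite -!mulrA mulVKr // !rmorphM !rmorphXn.
Qed.

Lemma heine_termE v (x : 'I_n.+1 -> K) (a b c : K) u :
  (fpsX * a%:S) ^+ mdeg u * (qpoch_comp q t b u)%:S
  / qpoch_comp q%:S t%:S (fpsX * c%:S * t%:S ^+ n) u
  * (gbinom q t u v)%:S * (meval x (interpMnorm q t u))%:S =
  heine_term q t v x a (b / t ^+ n) c u.
Proof.
have e (X A B C D E : fps K) : X * A * C / B * D * E = A * C * (D * E) * (X / B).
  by ring.
rewrite qpoch_comp_fps qpoch_comp_spoly /heine_term exprMn e; congr (_ * _).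
by rewrite -rmorphXn -!rmorphM.
Qed.

Lemma heine_seriesE v (x : 'I_n.+1 -> K) (a b c : K) :
  fps_sum (fun u : multinom n.+1 =>
    (fpsX * a%:S) ^+ mdeg u * (qpoch_comp q t b u)%:S
    / qpoch_comp q%:S t%:S (fpsX * c%:S * t%:S ^+ n) u
    * (gbinom q t u v)%:S * (meval x (interpMnorm q t u))%:S) =
  fps_sum (heine_term q t v x a (b / t ^+ n) c).
Proof. by congr fps_sum; apply/funext => u; exact: heine_termE. Qed.

End Specialization.

Theorem corollary10p2 (R : realType) (n : nat) (q t a b c : R[i])
    (v : multinom n) (x : 'I_n -> R[i]) :
  (0 < n)%N -> `|q| < 1 -> generic q t ->
  c != 0 -> qpoch_comp q t (a * b / c) v != 0 ->
  let za := fpsX * a%:S in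
  let zc := fpsX * c%:S in
  fps_sum (fun u : multinom n =>
    za ^+ mdeg u
    * (qpoch_comp q t b u)%:S
    / qpoch_comp q%:S t%:S (zc * t%:S ^+ n.-1) u
    * (gbinom q t u v)%:S * (meval x (interpMnorm q t u))%:S)
  = ((a / c) ^+ mdeg v
     * (qpoch_comp q t b v / qpoch_comp q t (a * b / c) v))%:S
    * \prod_(i < n)
        ((qpoch_infty q (za * t%:S ^+ (n - i.+1)) * qpoch_infty q (zc * (x i)%:S))
         / (qpoch_infty q (zc * t%:S ^+ (n - i.+1)) * qpoch_infty q (za * (x i)%:S)))
    * fps_sum (fun u : multinom n =>
        zc ^+ mdeg u
        * (qpoch_comp q t (a * b / c) u)%:S
        / qpoch_comp q%:S t%:S (za * t%:S ^+ n.-1) u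
        * (gbinom q t u v)%:S * (meval x (interpMnorm q t u))%:S).
Proof.
case: n v x => // n v x _ q1 gen c0; rewrite /= => nzv.
have nz k : 1 - q ^+ k.+1 != 0.
  by have := generic_neq1 gen 0 (ltn0Sn k); rewrite mulr1.
pose F := qinf_fps q.
have F0 : coefps F 0 = 1 by rewrite /= /qinf_coef big_ord0.
have F_eq := qinf_fps_eq nz.
have abE : a * b / c / t ^+ n = a / c * (b / t ^+ n) by ring.
rewrite !(qpoch_comp_spoly gen) abE in nzv *.
set X := (X in X = _); set Y := (Y in _ = _ * Y).
have -> : X = fps_sum (heine_term q t v x a (b / t ^+ n) c).
  exact: heine_seriesE.
have -> : Y = fps_sum (heine_term q t v x c (a / c * (b / t ^+ n)) a).
  by rewrite -abE; exact: heine_seriesE.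
rewrite {X Y} (heine_fps_sum gen F0 F_eq) //; congr (_ * _ * _).
(* The numerators are listed in reverse to match the exponents n - i of t in the theorem. *)
have Pscale e : fps_scale e (Pnum t n F * Pden F x) = \prod_(i < n.+1)
    (qinf F (e * t ^+ (n.+1 - i.+1)) / qinf F (e * x i)).
  rewrite rmorphM /Pnum (reindex_inj rev_ord_inj) /= !rmorph_prod -big_split.
  apply: eq_bigr => i _; rewrite rmorphV ?(qinf_unit F0) //=.
  by rewrite /qinf !fps_scale_scale.
rewrite !Pscale -prodrV => [|i _]; last by rewrite unitrM unitrV !(qinf_unit F0).
rewrite -big_split; apply: eq_bigr => i _ /=.
rewrite -!rmorphXn -!mulrA -!rmorphM !(qpoch_infty_scale (cvg_exp_complex q1)) //.
rewrite !invrM ?unitrV ?(qinf_unit F0) // invrK; ring.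
Qed.
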